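(* Let $1\le p<q\le\infty$. There is a constant $C_q>0$ depending only on $q$ such that the following holds for all $K>1$, $\varepsilon>0$ and $0<\delta<1/2$. Define $m$, $s$, $\eta$ as follows: - if $q\le 2$: $m:=\lceil 3\cdot 48^{1/(q-1)}K^{pq/(q-p)}\rceil$, $s:=1+\frac1{q-1}$, $\eta:=16^{1/(q-1)}K^{pq/(q-p)}\varepsilon^{-(1+1/(q-1))}$; - if $q\ge 2$: $m:=\lceil 144\,K^{pq/(q-p)}\rceil$, $s:=2$, $\eta:=16\,K^{pq/(q-p)}\varepsilon^{-2}$. Let $k$ and $k'$ be the least odd natural numbers such that $k,k'\ge 2\log\delta^{-1}/\log\frac43$ and, in addition, $k\ge\max\{4/(q-1),4\}$. Then the algorithm $A_{p,q,K}^{\varepsilon,\delta}:=A_{k,1,m}^{k',s,\eta}$ is $(\varepsilon,\delta)$-approximating on $\mathcal Y_{p,q,K}$, and for every $Y\in\mathcal Y_{p,q,K}$ its expected cost satisfies $$\bar n(A_{p,q,K}^{\varepsilon,\delta},Y)\le C_q\,K^{pq/(q-p)}\left(1+\left(\frac{\|Y-\mathbb E Y\|_1}{\varepsilon}\right)^{\max\{1+1/(q-1),\,2\}}\right)\log\delta^{-1}.$$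
   Context: Random variables are real-valued on a probability space $(\Omega,\Sigma,\mathbb P)$; $\|X\|_q=(\mathbb E|X|^q)^{1/q}$ for $q<\infty$ and $\|X\|_\infty$ is the essential supremum of $|X|$. For $1\le p<q\le\infty$ and $K>1$, $$\mathcal Y_{p,q,K}:=\{Y\in L_q\mid \|Y-\mathbb E Y\|_q\le K\|Y-\mathbb E Y\|_p\}.$$ For $q=\infty$ conventions are by limits: $pq/(q-p)=p$, $1/(q-1)=0$, $4/(q-1)=0$. Algorithm $A_{k,p,m}^{k',s,\eta}$ (parameters: odd natural numbers $k,k'$; integer $m\ge2$; reals $p,s\ge1$, $\eta$ positive). Input: i.i.d. copies $Y_1,Y_2,\dots$ of $Y$. Stage 1: put $n_1:=km$ and for $\ell=1,\dots,k$ $$\widehat M_m^{(\ell)}:=\frac1m\sum_{i=(\ell-1)m+1}^{\ell m}Y_i,\qquad \widehat R_m^{(\ell)}:=\frac1m\sum_{i=(\ell-1)m+1}^{\ell m}|Y_i-\widehat M_m^{(\ell)}|^p,$$ and let $\widehat R_{k,m}$ be the median of $\widehat R_m^{(1)},\dots,\widehat R_m^{(k)}$. Stage 2: put $m':=\max\{\lceil\eta(\widehat R_{k,m})^s\rceil,1\}$ and for $\ell=1,\dots,k'$ $$\widetilde M_{m'}^{(\ell)}:=\frac1{m'}\sum_{i=n_1+(\ell-1)m'+1}^{n_1+\ell m'}Y_i.$$ The output $A_{k,p,m}^{k',s,\eta}(Y)$ is the median of $\widetilde M_{m'}^{(1)},\dots,\widetilde M_{m'}^{(k')}$. In the claim the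 algorithm is used with first-moment estimation, i.e. with the exponent in stage 1 equal to $1$. The (random) cost is the number of copies used, $n(\omega,Y)=km+k'\max\{\lceil\eta(\widehat R_{k,m}(\omega))^s\rceil,1\}$, and the expected cost is $\bar n(A,Y):=\mathbb E\,n(\cdot,Y)$. An algorithm $A$ is $(\varepsilon,\delta)$-approximating on $\mathcal Y$ if $\mathbb P\{|A(Y)-\mathbb E Y|\le\varepsilon\}\ge1-\delta$ for all $Y\in\mathcal Y$. *)

(* Defs.v *)
From mathcomp Require Import all_boot all_order all_algebra finmap.
From mathcomp Require Import all_classical all_reals all_analysis.

Set Implicit Arguments.
Unset Strict Implicit.
Unset Printing Implicit Defensive.

Import Order.TTheory GRing.Theory Num.Theory.
Import numFieldNormedType.Exports.

Local Open Scope classical_set_scope.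
Local Open Scope ring_scope.

Definition mutually_independent d (T : measurableType d) (R : realType)
    (P : probability T R) (X : nat -> {RV P >-> R}) : Prop :=
  forall (J : {fset nat}) (B : nat -> set R),
    (forall i, measurable (B i)) ->
    P (\bigcap_(i in [set` J]) (X i @^-1` B i)) =
    (\prod_(i <- J) P (X i @^-1` B i))%E.
Arguments mutually_independent {d T R} P X.

(* [Ys i] is the copy written Y_{i+1} with one-based indices. *)
Definition iid_copies d (T : measurableType d) (R : realType)
    (P : probability T R) (Y : {RV P >-> R}) (Ys : nat -> {RV P >-> R}) : Prop :=
  mutually_independent P Ys /\
  forall i (B : set R), measurable B ->
    distribution P (Ys i) B = distribution P Y B.
Arguments iid_copies {d T R} P Y Ys.

Definition mean d (T : measurableType d) (R : realType)
    (P : probability T R) (Y : {RV P >-> R}) : R := fine 'E_P[Y].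
Arguments mean {d T R} P Y.

(* ||Y - E Y||_r; for [r = +oo], [Lnorm] is the essential supremum of the
   absolute value. *)
Definition centered_norm d (T : measurableType d) (R : realType)
    (P : probability T R) (r : \bar R) (Y : {RV P >-> R}) : \bar R :=
  'N[P]_r [EFin \o (fun w => Y w - mean P Y)].
Arguments centered_norm {d T R} P r Y.

Definition norm_ratio_class d (T : measurableType d) (R : realType)
    (P : probability T R) (p : R) (q : \bar R) (K : R) : set {RV P >-> R} :=
  [set Y : {RV P >-> R} | (Y : T -> R) \in Lfun P q /\
           (centered_norm P q Y <= K%:E * centered_norm P p%:E Y)%E].
Arguments norm_ratio_class {d T R} P p q K.

Definition ceil_nat (R : realType) (x : R) : nat := `|Num.ceil x|%N.

(* Used only for sequences of odd length, where it is the middle order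
   statistic. *)
Definition median (R : realType) (s : seq R) : R :=
  nth 0 (sort <=%R s) (size s)./2.

(* An algorithm sees a realization [y] of the sequence of copies and returns an
   output together with the number of copies it has used. *)
Record algorithm (R : realType) := Algorithm {
  output : (nat -> R) -> R ;
  cost : (nat -> R) -> nat }.

Definition block_mean (R : realType) (n0 m : nat) (y : nat -> R) (l : nat) : R :=
  (\sum_(n0 + l * m <= i < n0 + l.+1 * m) y i) / m%:R.

Definition block_moment (R : realType) (p : R) (m : nat) (y : nat -> R)
    (l : nat) : R :=
  (\sum_(l * m <= i < l.+1 * m) `|y i - block_mean 0 m y l| `^ p) / m%:R.

Definition median_of_moments (R : realType) (k : nat) (p : R) (m : nat)
    (y : nat -> R) : R :=
  median [seq block_moment p m y l | l <- iota 0 k].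

Definition median_of_means (R : realType) (n0 k m : nat) (y : nat -> R) : R :=
  median [seq block_mean n0 m y l | l <- iota 0 k].

Definition second_stage_size (R : realType) (k : nat) (p : R) (m : nat)
    (s eta : R) (y : nat -> R) : nat :=
  maxn (ceil_nat (eta * median_of_moments k p m y `^ s)) 1.

Definition adaptive_algorithm (R : realType) (k : nat) (p : R) (m : nat)
    (k' : nat) (s eta : R) : algorithm R :=
  {| output := fun y =>
       median_of_means (k * m) k' (second_stage_size k p m s eta y) y ;
     cost := fun y => (k * m + k' * second_stage_size k p m s eta y)%N |}.

Definition approximating d (T : measurableType d) (R : realType)
    (P : probability T R) (eps delta : R) (A : algorithm R)
    (F : set {RV P >-> R}) : Prop :=
  forall (Y : {RV P >-> R}) (Ys : nat -> {RV P >-> R}),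
    F Y -> iid_copies P Y Ys ->
    ((1 - delta)%:E <=
     P [set w | (`|output A (fun i => Ys i w) - mean P Y| <= eps)%R])%E.
Arguments approximating {d T R} P eps delta A F.

Definition expected_cost d (T : measurableType d) (R : realType)
    (P : probability T R) (A : algorithm R) (Ys : nat -> {RV P >-> R}) : \bar R :=
  'E_P[(fun w => (cost A (fun i => Ys i w))%:R : R)].
Arguments expected_cost {d T R} P A Ys.

(* 1/(q-1), with value 0 at q = +oo. *)
Definition inv_pred (R : realType) (q : \bar R) : R :=
  if q is r%:E then (r - 1)^-1 else 0.

(* pq/(q-p), with value p at q = +oo. *)
Definition ratio_exponent (R : realType) (p : R) (q : \bar R) : R :=
  if q is r%:E then p * r / (r - p) else p.

(* In the next three definitions both branches agree at q = 2. *)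
Definition first_block_size (R : realType) (p : R) (q : \bar R) (K : R) : nat :=
  if (q <= 2%:E)%E then
    ceil_nat (3 * 48 `^ inv_pred q * K `^ ratio_exponent p q)
  else ceil_nat (144 * K `^ ratio_exponent p q).

Definition size_exponent (R : realType) (q : \bar R) : R :=
  if (q <= 2%:E)%E then 1 + inv_pred q else 2.

Definition size_factor (R : realType) (p : R) (q : \bar R) (K eps : R) : R :=
  if (q <= 2%:E)%E then
    16 `^ inv_pred q * K `^ ratio_exponent p q * eps `^ (- (1 + inv_pred q))
  else 16 * K `^ ratio_exponent p q * eps ^- 2.

Definition least_odd_geq (R : realType) (x : R) (k : nat) : Prop :=
  [/\ odd k, x <= k%:R & forall j : nat, odd j -> x <= j%:R -> (k <= j)%N].

(* Main.v *)
(** Put r = min(q, 2), X = Y - E Y, rho = E|X| and kap = K^(pq/(q-p)).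
    Log-convexity of the moments turns the norm-ratio condition into
    E|X|^r <= kap^(r-1) rho^r.  By the von Bahr-Esseen inequality with constant
    2^(2-r), a sum of n independent centered variables has r-th absolute moment
    at most n 2^(2-r) max E|.|^r.  With Markov's inequality this makes each
    block statistic of stage 1 at least rho/2, and each block mean of stage 2
    eps-accurate as soon as the stage-1 median is at least rho/2, with
    probability at least 3/4.  A median of independent blocks fails only if a
    majority of the blocks fail, and the requirement on k and k' makes this
    probability at most delta/2 in each stage.

    For the cost, if k = 2N - 1 then the N-th power of the stage-1 median is at
    most the N-th elementary symmetric polynomial of the independent block
    statistics, whose expectation is at most (8 rho)^N.  Since
    k >= 4/(r-1) gives s = r/(r-1) <= N, this controls the s-th moment. *)

Require Import Defs.
From mathcomp Require Import all_boot all_order all_algebra finmap.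
From mathcomp Require Import all_classical all_reals all_analysis.
From mathcomp Require Import measurable_realfun ess_sup_inf.
From mathcomp Require Import ring lra zify.
Set Implicit Arguments.
Unset Strict Implicit.
Unset Printing Implicit Defensive.

Import Order.TTheory GRing.Theory Num.Theory.
Import numFieldNormedType.Exports.

Local Open Scope classical_set_scope.
Local Open Scope ring_scope.

(** * A von Bahr-Esseen inequality for powers *)

(** If r < 2, then s = r/(r-1) exceeds r, so the s-th moment of Y may be infinite and no single
    block statistic controls the expected cost. The median does: it is at least t only if at least N
    independent block statistics are, and only their first moments enter, which keeps further powers
    of K out of the bound. Probabilities are equally tight. From an exponential-moment bound
    (3/4)^(k/2) the requirement on k and k' would give only delta, while the union over both stages
    asks for delta/2; counting majorities supplies the missing factor. The size of stage 2 is random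
    and depends on the same sequence of copies. For a fixed size j, however, failure is an event
    about copies with index at least k m, hence independent of the event that stage 1 selects j, so
    that summing over the countably many j costs nothing. *)

Section RealInequalities.
Variable R : realType.
Implicit Types (a b x y r t : R).

Lemma is_derive_ge0_le (f df : R -> R) a b :
  a <= b -> (forall x, a <= x <= b -> is_derive x 1 f (df x)) ->
  (forall x, a <= x <= b -> 0 <= df x) -> f a <= f b.
Proof.
move=> ab fdf df0; rewrite -subr_ge0.
have [x xab| |c] := @MVT_segment R f df a b ab.
- by apply: fdf; move: xab; rewrite in_itv/= => /andP[/ltW -> /ltW ->].
- apply: derivable_within_continuous => x; rewrite in_itv/= => /fdf dx.
  exact: ex_derive.
by rewrite in_itv/= => cab ->; rewrite mulr_ge0 ?subr_ge0 ?df0.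
Qed.

(** Young's inequality for the product of t^r and 1, with conjugate exponents 1/r and 1/(1-r). The
    values r = 0 and r = 1 are split off because there one exponent degenerates. *)
Lemma powR_bernoulli t r : 0 <= t -> 0 <= r <= 1 -> t `^ r <= 1 + r * (t - 1).
Proof.
move=> t0 /andP[r0 r1].
have [->|rn0] := eqVneq r 0; first by rewrite powRr0; lra.
have [->|rn1] := eqVneq r 1; first by rewrite powRr1//; lra.
have rgt0 : 0 < r by rewrite lt_neqAle eq_sym rn0.
have rlt1 : 0 < 1 - r by rewrite subr_gt0 lt_neqAle rn1.
have := @conjugate_powR R (t `^ r) 1 r^-1 (1 - r)^-1 (powR_ge0 _ _) ler01.
rewrite !invr_gt0 !invrK => /(_ rgt0 rlt1).
rewrite -powRrM mulfV// powRr1// powR1 => H.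
have := H ltac:(lra); lra.
Qed.

(** A fraction z/(x+y) in [0, 1] is at most its r-th power; the fractions for z = x and z = y add up
    to 1. *)
Lemma powR_subadditive x y r :
  0 <= x -> 0 <= y -> 0 < r <= 1 -> (x + y) `^ r <= x `^ r + y `^ r.
Proof.
move=> x0 y0 /andP[r0 r1].
have [s0|s0] := eqVneq (x + y) 0.
  by rewrite s0 powR0 ?gt_eqF// addr_ge0// powR_ge0.
have sgt0 : 0 < x + y by rewrite lt_neqAle eq_sym s0 addr_ge0.
have frac (z : R) : 0 <= z -> z <= x + y ->
    z / (x + y) * (x + y) `^ r <= z `^ r.
  move=> z0 zs; rewrite -[in leRHS](divfK s0 z).
  rewrite powRM ?(ltW sgt0) ?(divr_ge0 z0 (ltW sgt0))//.
  rewrite ler_wpM2r// ?powR_ge0//.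
  have [->|zn0] := eqVneq z 0; first by rewrite mul0r powR_ge0.
  rewrite ger1_powR// divr_gt0//=; last by rewrite lt_neqAle eq_sym zn0.
  by rewrite ler_pdivrMr// mul1r.
have := lerD (frac x x0 _) (frac y y0 _).
rewrite -mulrDl -mulrDl mulfV// mul1r; apply; lra.
Qed.

(** Concavity: both powers lie below the tangent at the midpoint m, which is [powR_bernoulli] scaled
    by m, and the linear terms cancel in the sum. *)
Lemma powR_half_sum x y r :
  0 <= x -> 0 <= y -> 0 <= r <= 1 ->
  x `^ r + y `^ r <= 2 `^ (1 - r) * (x + y) `^ r.
Proof.
move=> x0 y0 r01; have /andP[r0 r1] := r01.
have [s0|s0] := eqVneq (x + y) 0.
  have -> : x = 0 by lra.
  have -> : y = 0 by lra.
  have [->|rn0] := eqVneq r 0.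
    by rewrite !powRr0 subr0 powRr1//; lra.
  by rewrite addr0 powR0// mulr0 addr0.
have sgt0 : 0 < x + y by rewrite lt_neqAle eq_sym s0 addr_ge0.
pose m := (x + y) / 2.
have m0 : 0 < m by rewrite divr_gt0.
have aux (z : R) : 0 <= z -> z `^ r <= (1 + r * (z / m - 1)) * m `^ r.
  move=> z0; have zm0 := divr_ge0 z0 (ltW m0).
  rewrite -[in leLHS](divfK (lt0r_neq0 m0) z) powRM ?(ltW m0)//.
  by rewrite ler_wpM2r ?powR_ge0// powR_bernoulli.
have -> : 2 `^ (1 - r) * (x + y) `^ r = 2 * m `^ r.
  rewrite /m powRM ?(ltW sgt0) ?invr_ge0//.
  rewrite [2^-1 `^ r](_ : _ = 2 `^ (- r)).
    rewrite powRD ?implybT//; last by rewrite pnatr_eq0 implybT.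
    by rewrite powRr1//; ring.
  by rewrite -[2^-1]powR_inv1// -powRrM mulN1r.
have := lerD (aux _ x0) (aux _ y0).
rewrite -mulrDl => /le_trans; apply.
rewrite ler_wpM2r ?powR_ge0//.
have -> : 1 + r * (x / m - 1) + (1 + r * (y / m - 1)) =
  2 + r * ((x + y) / m - 2) by lra.
rewrite /m invfM mulrA mulfV// invrK mul1r; lra.
Qed.

(* Stands in for continuity at an endpoint where the base of a power vanishes
   and the power is not differentiable. *)
Lemma le_of_linear_approx (u C : R) :
  (forall e, 0 < e -> e < 1 -> - (C * e) <= u) -> 0 <= u.
Proof.
move=> H; rewrite leNgt; apply/negP => u0.
have D0 : 0 < `|C| + 1 - u by have := normr_ge0 C; lra.
pose e := - u / (2 * (`|C| + 1 - u)).
have e0 : 0 < e by rewrite divr_gt0 ?mulr_gt0 ?oppr_gt0.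
have De : 2 * e * (`|C| + 1 - u) = - u by rewrite /e; field; apply/lt0r_neq0.
have e1 : e < 1.
  have := normr_ge0 C; nra.
have := H e e0 e1; have := ler_norm C; nra.
Qed.

Lemma is_derive_powR_comp (f : R -> R) (df r x : R) : 0 < f x ->
  is_derive x 1 f df ->
  is_derive x 1 (fun y => f y `^ r) (r * f x `^ (r - 1) * df).
Proof.
move=> fx0 fdf.
have H := is_derive1_powR r fx0.
have := @is_derive1_comp R (fun y => y `^ r) f x _ _ H fdf.
by [].
Qed.

End RealInequalities.

(** * The pointwise estimate of |a + b|^r *)

Section VonBahrEsseen.
Variable R : realType.
Implicit Types (a b x y r t : R).

Lemma powR_ge1 (a r : R) : 1 <= a -> 0 <= r -> 1 <= a `^ r.
Proof. by move=> a1 r0; rewrite -[leLHS](powRr0 a) ler_powR. Qed.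

(** The common shape of the difference functions [h] in the next three lemmas, where (C, s) is (1,
    1), (1, -1) and (-1, 1). *)
Lemma is_derive_powR_affine (r A B C D s y : R) : 0 < y -> 0 < C + s * y ->
  is_derive y 1 (fun z => A + B * z + D * z `^ r - (C + s * z) `^ r)
    (B + D * (r * y `^ (r - 1)) - r * (C + s * y) `^ (r - 1) * s).
Proof.
move=> y0 Cy0.
have aff (a b : R) : is_derive y 1 (fun z => a + b * z) b.
  have d := is_deriveD (is_derive_cst a y 1)
    (is_deriveZ b (is_derive_id y (1 : R))).
  by apply: (is_derive_eq d); rewrite add0r /GRing.scale/= mulr1.
have d1 := is_derive1_powR r y0.
have d2 := @is_derive_powR_comp R _ _ r y Cy0 (aff C s).
exact: (is_deriveB (is_deriveD (aff A B) (is_deriveZ D d1)) d2).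
Qed.

(** The difference of the two sides vanishes at 0 and increases, since its derivative is nonnegative
    by subadditivity of the power r - 1. *)
Lemma powR1p_le (r x : R) : 1 < r <= 2 -> 0 <= x ->
  (1 + x) `^ r <= 1 + r * x + x `^ r.
Proof.
move=> /andP[r1 r2]; rewrite le_eqVlt => /predU1P[<-|x0].
  by rewrite addr0 powR1 mulr0 addr0 lerDl powR_ge0.
pose h (y : R) := 1 + r * y + 1 * y `^ r - (1 + 1 * y) `^ r.
have mono (y : R) : 0 < y -> y <= x -> h y <= h x.
  move=> y0 yx.
  apply: (@is_derive_ge0_le R h (fun z => r + 1 * (r * z `^ (r - 1)) -
    r * (1 + 1 * z) `^ (r - 1) * 1) y x yx) => z /andP[yz zx].
    by apply: is_derive_powR_affine; lra.
  have z0 : 0 <= z by lra.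
  have := @powR_subadditive R 1 z (r - 1) ler01 z0.
  by rewrite powR1 !mul1r => H; have := H ltac:(lra); nra.
suff : 0 <= h x.
  by rewrite /h ?mul1r ?mulN1r ?(addrC (- 1)) ?mulNr; lra.
(* Near 0 the bound (1+e)^r <= (1+e)^2 gives [h e] >= -3e, which replaces the value of [h] at 0. *)
apply: (@le_of_linear_approx R _ (3 + x^-1 * 3)) => e e0 e1.
have [ex|xe] := leP e x.
  apply: le_trans (mono e e0 ex); rewrite /h ?mul1r ?mulN1r ?(addrC (- 1)) ?mulNr.
  have : (1 + e) `^ r <= (1 + e) ^+ 2.
    by rewrite -powR_mulrn ?ler_powR//; lra.
  have := powR_ge0 e r; have : 0 <= x^-1 * 3 * e by rewrite !mulr_ge0 ?invr_ge0 ?ltW.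
  by nra.
have := mono x x0 (lexx _).
have : (1 + x) `^ r <= (1 + x) ^+ 2.
  by rewrite -powR_mulrn ?ler_powR//; lra.
rewrite /h ?mul1r ?mulN1r ?(addrC (- 1)) ?mulNr.
have := powR_ge0 x r; have : 0 <= x^-1 * 3 * e by rewrite !mulr_ge0 ?invr_ge0 ?ltW.
by nra.
Qed.

(** Again the difference increases from 0: the derivative is nonnegative because z^(r-1) +
    (1-z)^(r-1) >= 1 and 2^(2-r) >= 1. The point x = 1 is separate, as the base 1 - x vanishes
    there. *)
Lemma powR_1B_le (r x : R) : 1 < r <= 2 -> 0 <= x <= 1 ->
  (1 - x) `^ r <= 1 - r * x + 2 `^ (2 - r) * x `^ r.
Proof.
move=> /andP[r1 r2] /andP[]; rewrite le_eqVlt => /predU1P[<- _|x0].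
  by rewrite subr0 powR1 mulr0 subr0 lerDl mulr_ge0 ?powR_ge0.
rewrite le_eqVlt => /predU1P[->|x1].
  rewrite subrr powR0 ?powR1; last by apply/eqP; lra.
  have : 1 <= 2 `^ (2 - r) by apply: powR_ge1; lra.
  by lra.
pose h (y : R) := 1 + (- r) * y + 2 `^ (2 - r) * y `^ r - (1 + (- 1) * y) `^ r.
have mono (y : R) : 0 < y -> y <= x -> h y <= h x.
  move=> y0 yx.
  apply: (@is_derive_ge0_le R h (fun z => - r + 2 `^ (2 - r) * (r * z `^ (r - 1)) -
    r * (1 + (- 1) * z) `^ (r - 1) * (- 1)) y x yx) => z /andP[yz zx].
    by apply: is_derive_powR_affine; lra.
  have z0 : 0 <= z by lra.
  rewrite mulN1r.
  have := @powR_subadditive R z (1 - z) (r - 1) z0.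
  rewrite subrKC powR1 => H.
  have := H ltac:(lra) ltac:(lra).
  have : 1 <= 2 `^ (2 - r) by apply: powR_ge1; lra.
  move: ((1 - z) `^ _) (2 `^ _) (z `^ _) (powR_ge0 z (r - 1)) => u v w w0 v1 uw.
  have -> : - r + v * (r * w) - r * u * -1 = r * (v * w + u - 1) by ring.
  by apply: mulr_ge0; nra.
suff : 0 <= h x.
  by rewrite /h ?mul1r ?mulN1r ?(addrC (- 1)) ?mulNr; lra.
apply: (@le_of_linear_approx R _ (2 + x^-1 * 2)) => e e0 e1.
have xe0 : 0 <= x^-1 * 2 * e by rewrite !mulr_ge0 ?invr_ge0 ?ltW.
have [ex|xe] := leP e x.
  apply: le_trans (mono e e0 ex); rewrite /h ?mul1r ?mulN1r ?(addrC (- 1)) ?mulNr.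
  have : (1 - e) `^ r <= 1 - e by rewrite ge1r_powR//; lra.
  have : 0 <= 2 `^ (2 - r) * e `^ r by rewrite mulr_ge0 ?powR_ge0.
  by nra.
have : (1 - x) `^ r <= 1 - x by rewrite ge1r_powR//; lra.
have : 0 <= 2 `^ (2 - r) * x `^ r by rewrite mulr_ge0 ?powR_ge0.
by rewrite /h ?mul1r ?mulN1r ?(addrC (- 1)) ?mulNr; nra.
Qed.

(** At x = 1 the difference is 1 - r + 2^(2-r) >= 0. It increases because [powR_half_sum] gives
    (z-1)^(r-1) + 1 <= 2^(2-r) z^(r-1); this is where the factor 2^(2-r) enters. *)
Lemma powR_B1_le (r x : R) : 1 < r <= 2 -> 1 <= x ->
  (x - 1) `^ r <= 1 - r * x + 2 `^ (2 - r) * x `^ r.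
Proof.
move=> r12 x1; have /andP[r1 r2] := r12.
have base : 0 <= 1 - r + 2 `^ (2 - r).
  have : 1 <= 2 `^ (2 - r) by apply: powR_ge1; lra.
  by lra.
move: x1; rewrite le_eqVlt => /predU1P[<-|x1].
  by rewrite subrr powR0 ?powR1 ?mulr1//; apply/eqP; lra.
pose h (y : R) := 1 + (- r) * y + 2 `^ (2 - r) * y `^ r - ((- 1) + 1 * y) `^ r.
have mono (y : R) : 1 < y -> y <= x -> h y <= h x.
  move=> y0 yx.
  apply: (@is_derive_ge0_le R h (fun z => - r + 2 `^ (2 - r) * (r * z `^ (r - 1)) -
    r * ((- 1) + 1 * z) `^ (r - 1) * 1) y x yx) => z /andP[yz zx].
    by apply: is_derive_powR_affine; lra.
  have z0 : 0 <= z by lra.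
  have z1 : 0 <= z - 1 by lra.
  rewrite mul1r (addrC (- 1)).
  have := @powR_half_sum R (z - 1) 1 (r - 1) z1 ler01.
  rewrite subrK powR1.
  rewrite (_ : 1 - (r - 1) = 2 - r); last by ring.
  move=> H; have := H ltac:(lra).
  move: ((z - 1) `^ _) (2 `^ _) (z `^ _) => u v w uv.
  have -> : - r + v * (r * w) - r * u * 1 = r * (v * w - u - 1) by ring.
  by apply: mulr_ge0; lra.
suff : 0 <= h x.
  by rewrite /h ?mul1r ?mulN1r ?(addrC (- 1)) ?mulNr; lra.
apply: (@le_of_linear_approx R _ (1 + r + (r * x) * (x - 1)^-1 + 2)) => e e0 e1.
have pow1 (y : R) : 1 < y -> 1 <= y `^ r by move=> y1; apply: powR_ge1; lra.
have G : 0 <= 2 `^ (2 - r) := powR_ge0 _ _.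
have xe0 : 0 <= (r * x) * (x - 1)^-1 * e by rewrite !mulr_ge0 ?invr_ge0 ?subr_ge0 ?(ltW x1) ?(ltW e0)//; lra.
have [ex|xe] := leP (1 + e) x.
  apply: le_trans (mono (1 + e) _ ex); last by lra.
  rewrite /h ?mul1r ?mulN1r ?(addrC (- 1)) ?mulNr.
  rewrite (_ : 1 + e - 1 = e); last by ring.
  have : e `^ r <= e by rewrite ge1r_powR//; lra.
  have := pow1 (1 + e) ltac:(lra).
  by nra.
have : (x - 1) `^ r <= x - 1 by rewrite ge1r_powR//; lra.
have := pow1 _ x1.
rewrite /h ?mul1r ?mulN1r ?(addrC (- 1)) ?mulNr; nra.
Qed.

(* The factor [2 `^ (2 - r)] is sharp at both ends (it is 2 at [r = 1] and 1
   at [r = 2]); the constants of the algorithm leave no room for the cruder 2. *)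
Lemma powR_norm_add (r a b : R) : 1 < r <= 2 ->
  `|a + b| `^ r <=
  `|a| `^ r + r * (Num.sg a * `|a| `^ (r - 1)) * b + 2 `^ (2 - r) * `|b| `^ r.
Proof.
move=> r12; have /andP[r1 r2] := r12.
have c1 : 1 <= 2 `^ (2 - r) :> R by apply: powR_ge1; lra.
have normalized (x : R) : `|1 + x| `^ r <= 1 + r * x + 2 `^ (2 - r) * `|x| `^ r.
  have [x0|x0] := leP 0 x.
    rewrite !ger0_norm ?addr_ge0//.
    apply: (le_trans (powR1p_le r12 x0)).
    by rewrite lerD2l ler_peMl ?powR_ge0.
  rewrite (ltr0_norm x0).
  have [x1|x1] := leP (- x) 1.
    rewrite ger0_norm; last by lra.
    by have := @powR_1B_le r (- x) r12 ltac:(lra); rewrite opprK mulrN opprK.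
  rewrite ltr0_norm; last by lra.
  rewrite opprD addrC.
  by have := @powR_B1_le r (- x) r12 ltac:(lra); rewrite mulrN opprK.
have [->|a0] := eqVneq a 0.
  rewrite sgr0 add0r normr0 powR0 ?mul0r ?mulr0 ?mul0r ?add0r; last by apply/eqP; lra.
  by rewrite ler_peMl ?powR_ge0.
have na0 : 0 < `|a| by rewrite normr_gt0.
suff main x : `|a + a * x| `^ r <= `|a| `^ r +
    r * (Num.sg a * `|a| `^ (r - 1)) * (a * x) + 2 `^ (2 - r) * `|a * x| `^ r.
  by have := main (b / a); rewrite mulrCA mulfV// mulr1.
have -> : a + a * x = a * (1 + x) by ring.
have -> : r * (Num.sg a * `|a| `^ (r - 1)) * (a * x) = `|a| `^ r * (r * x).
  have rp : 0 < r by lra.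
  transitivity ((Num.sg a * a) * `|a| `^ (r - 1) * (r * x)); first by ring.
  by rewrite -normrEsg mulr_powRB1// ltW.
rewrite !normrM !powRM//.
have := ler_wpM2l (powR_ge0 `|a| r) (normalized x).
by lra.
Qed.

(** This is [powR_half_sum] with exponent 1/r for x^r and y^r, raised to the power r. *)
Lemma powR_add_le (r x y : R) : 1 <= r -> 0 <= x -> 0 <= y ->
  (x + y) `^ r <= 2 `^ (r - 1) * (x `^ r + y `^ r).
Proof.
move=> r1 x0 y0.
have r0 : 0 < r by lra.
have := @powR_half_sum R (x `^ r) (y `^ r) r^-1 (powR_ge0 _ _) (powR_ge0 _ _).
rewrite -!powRrM mulfV ?lt0r_neq0// !powRr1// => H.
have r01 : 0 <= r^-1 <= 1 by rewrite invr_ge0 (ltW r0) invf_le1.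
have := @ge0_ler_powR R r (ltW r0) _ _ _ _ (H r01).
rewrite !nnegrE addr_ge0// mulr_ge0 ?powR_ge0// => /(_ isT isT).
rewrite powRM ?powR_ge0// -!powRrM mulVf ?lt0r_neq0// powRr1 ?addr_ge0 ?powR_ge0//.
by rewrite mulrBl mul1r mulVf ?lt0r_neq0.
Qed.

End VonBahrEsseen.

(** * Independence *)

Section Independence.
Context d (T : measurableType d) (R : realType) (P : probability T R).
Variable X : nat -> {RV P >-> R}.

(** Finite intersections rather than single preimages: they form a pi-system containing [setT]
    (empty [J]), and [mutually_independent] speaks about them directly. *)
Definition cylinders (A : set nat) : set_system T :=
  [set E | exists (J : {fset nat}) (B : nat -> set R),
    [/\ [set` J] `<=` A, forall i, measurable (B i) &
        E = \bigcap_(i in [set` J]) (X i @^-1` B i)]].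

Lemma cylinders_measurable A : cylinders A `<=` measurable.
Proof.
move=> _ [J [B [_ mB ->]]].
by apply: fin_bigcap_measurable => // i _; exact: measurable_funPTI.
Qed.

Lemma sub_cylinders A B : A `<=` B -> cylinders A `<=` cylinders B.
Proof. by move=> AB _ [J [C [JA mC ->]]]; exists J, C; split=> // i /JA /AB. Qed.

Lemma cylinders_setT A : cylinders A setT.
Proof.
exists fset0, (fun=> setT); split=> //.
by apply/seteqP; split=> // w _ i.
Qed.

Lemma cylinders_preimage A i B : A i -> measurable B -> cylinders A (X i @^-1` B).
Proof.
move=> Ai mB; exists [fset i]%fset, (fun=> B); split=> //.
- by move=> j /=; rewrite inE => /eqP ->.
- apply/seteqP; split => [w XiB j /=|w /(_ i)].
    by rewrite inE => /eqP ->.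
  by apply; rewrite /= inE.
Qed.

Lemma cylinders_setI_closed A : setI_closed (cylinders A).
Proof.
move=> _ _ [J [B [JA mB ->]]] [K [C [KA mC ->]]].
exists (J `|` K)%fset,
  (fun i => (if i \in J then B i else setT) `&` (if i \in K then C i else setT)).
split.
- by move=> i /=; rewrite inE => /orP[/JA|/KA].
- by move=> i; apply: measurableI; case: ifP.
- apply/seteqP; split=> [w [wJ wK] i /=|w H].
    by move=> _; split; case: ifPn => // ?; [exact: wJ|exact: wK].
  split=> i /= iJ.
    by have := H i; rewrite /= inE iJ => /(_ isT)[].
  by have := H i; rewrite /= inE iJ orbT => /(_ isT)[].
Qed.

Definition events (A : set nat) : set_system T := <<s cylinders A >>.

Lemma events_measurable A : events A `<=` measurable.
Proof.
apply: smallest_sub; last exact: cylinders_measurable.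
exact: sigma_algebra_measurable.
Qed.

Lemma sub_events A B : A `<=` B -> events A `<=` events B.
Proof.
move=> AB; apply: smallest_sub; first exact: smallest_sigma_algebra.
by apply: subset_trans (sub_cylinders AB) _; exact: sub_sigma_algebra.
Qed.

Hypothesis indepX : mutually_independent P X.

Lemma cylinders_indep A B E F : A `&` B = set0 ->
  cylinders A E -> cylinders B F -> P (E `&` F) = (P E * P F)%E.
Proof.
move=> AB [J [C [JA mC ->]]] [K [D [KB mD ->]]].
have JK i : i \in J -> i \in K = false.
  move=> iJ; apply/negP => iK.
  by have : (A `&` B) i by [split; [exact: JA|exact: KB]]; rewrite AB.
(* One family of sets serving both [J] and [K], so that the product formula applies to [J], to [K]
   and to their union. *)
pose G i := if i \in J then C i else D i.
have mG i : measurable (G i) by rewrite /G; case: ifP.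
have -> : \bigcap_(i in [set` J]) (X i @^-1` C i) =
          \bigcap_(i in [set` J]) (X i @^-1` G i).
  by apply: eq_bigcapr => i /= iJ; rewrite /G iJ.
have -> : \bigcap_(i in [set` K]) (X i @^-1` D i) =
          \bigcap_(i in [set` K]) (X i @^-1` G i).
  apply: eq_bigcapr => i /= iK; rewrite /G ifN//.
  by apply/negP => /JK; rewrite iK.
rewrite -bigcap_setU -set_fsetU !indepX//.
rewrite -big_cat; apply: perm_big; apply: uniq_perm.
- exact: fset_uniq.
- rewrite cat_uniq !fset_uniq andbT /=; apply/hasPn => i iK.
  by apply/negP => /JK; rewrite iK.
- by move=> i; rewrite mem_cat inE.
Qed.

(** The finite measures F |-> P(F & E) and F |-> P(E) P(F) agree on the pi-system of cylinders,
    hence on the sigma-algebra it generates. Independence of two sigma-algebras needs this once for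
    each of them. *)
Lemma events_indep_step A (E : set T) : measurable E ->
  (forall F, cylinders A F -> P (F `&` E) = (P E * P F)%E) ->
  forall F, events A F -> P (F `&` E) = (P E * P F)%E.
Proof.
move=> mE H F AF.
have PE0 : 0 <= fine (P E) by exact: fine_ge0.
have PEfin : P E \is a fin_num by exact: fin_num_measure.
pose m1 : measure T R := mrestr P mE.
pose m2 : measure T R := mscale (NngNum PE0) P.
have m1E G : m1 G = P (G `&` E) by [].
have m2E G : m2 G = (P E * P G)%E by rewrite /m2 /= /mscale /= fineK.
rewrite -m1E -m2E; apply: (@g_sigma_algebra_measure_unique d R T (cylinders A)
  (@cylinders_measurable A) (fun=> setT) (fun=> cylinders_setT A)) => //.
- by apply/seteqP; split=> // w _; exists 0%N.
- exact: cylinders_setI_closed.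
- by move=> G /H; rewrite m1E m2E.
- by move=> _; rewrite m1E setTI ltey_eq PEfin.
Qed.

Lemma events_indep A B E F : A `&` B = set0 ->
  events A E -> events B F -> P (E `&` F) = (P E * P F)%E.
Proof.
move=> AB AE BF; have mE := events_measurable AE.
rewrite setIC; apply: (events_indep_step mE _ BF) => G BG.
rewrite setIC muleC; apply: (events_indep_step _ _ AE) => [|H AH].
  exact: cylinders_measurable BG.
by rewrite (cylinders_indep AB AH BG) muleC.
Qed.

End Independence.

(** * Random variables that depend only on given copies *)

Section Adapted.
Context d (T : measurableType d) (R : realType) (P : probability T R).
Variable X : nat -> {RV P >-> R}.

(** Measurability with respect to the sigma-algebra of the [X i] with [i] in [A]. Stated on
    [g_sigma_algebraType], it inherits the closure properties of measurable functions. *)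
Definition adapted (A : set nat) (f : T -> R) : Prop :=
  measurable_fun [set: g_sigma_algebraType (cylinders X A)] f.

Lemma adapted_preimage A (f : T -> R) B :
  adapted A f -> measurable B -> events X A (f @^-1` B).
Proof. by move=> mf mB; have := mf measurableT B mB; rewrite setTI. Qed.

Lemma adapted_sub A B (f : T -> R) : A `<=` B -> adapted A f -> adapted B f.
Proof.
by move=> AB mf _ C mC; rewrite setTI; apply: (sub_events AB); exact: adapted_preimage.
Qed.

Lemma adapted_measurable A (f : T -> R) : adapted A f -> measurable_fun setT f.
Proof.
move=> mf _ C mC; rewrite setTI; apply: (@events_measurable _ _ _ _ X A).
exact: adapted_preimage.
Qed.

Lemma adapted_RV (A : set nat) i : A i -> adapted A (X i).
Proof.
by move=> Ai _ C mC; rewrite setTI; apply: sub_sigma_algebra; exact: cylinders_preimage.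
Qed.

Hypothesis indepX : mutually_independent P X.

(** The joint law of U and V equals the product of the marginals, since the two agree on rectangles;
    Tonelli does the rest. The iterated form allows estimating the inner integral with U frozen. *)
Lemma indep_integral (A B : set nat) (U V : T -> R) 
    (f : R * R -> \bar R) :
  A `&` B = set0 -> adapted A U -> adapted B V ->
  measurable_fun setT f -> (forall x, (0 <= f x)%E) ->
  (\int[P]_w f (U w, V w) = \int[P]_w \int[P]_v f (U w, V v))%E.
Proof.
move=> AB AU BV mf f0.
have mU := adapted_measurable AU; have mV := adapted_measurable BV.
pose Um : {mfun T >-> R} := mfun_Sub (mem_set mU).
pose Vm : {mfun T >-> R} := mfun_Sub (mem_set mV).
have mZ : measurable_fun setT (fun w => (U w, V w)) by exact: measurable_fun_pair.
pose Z : {mfun T >-> (R * R)%type} := mfun_Sub (mem_set mZ).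
have E1 := ge0_integral_distribution (P := P) Z mf f0.
rewrite -[LHS]E1.
have -> : (\int[distribution P Z]_z f z =
    \int[distribution P Um \x distribution P Vm]_z f z)%E.
  apply: eq_measure_integral => C mC _; apply/esym.
  apply: product_measure_unique => // D E mD mE.
  rewrite /distribution /pushforward.
  apply: (events_indep indepX AB); exact: adapted_preimage.
rewrite fubini_tonelli1// ge0_integral_distribution//.
- apply: eq_integral => w _; rewrite /= /fubini_F ge0_integral_distribution//.
  exact: measurableT_comp mf (pair1_measurable _).
- exact: measurable_fun_fubini_tonelli_F.
- by move=> x; apply: integral_ge0.
Qed.

End Adapted.

(** * Markov's inequality and r-th moments of sums *)

Section Moments.
Context d (T : measurableType d) (R : realType) (P : probability T R).

Lemma measurable_normpowR (f : T -> R) (r : R) :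
  measurable_fun setT f -> measurable_fun setT (fun w => `|f w| `^ r).
Proof.
move=> mf; apply: (measurableT_comp (measurable_powR r)).
exact: measurableT_comp.
Qed.

Lemma integral_cst_prob (c : R) : (\int[P]_w c%:E = c%:E)%E.
Proof.
rewrite (_ : (fun=> c%:E) = cst c%:E)// integral_cst//.
by rewrite [X in (_ * X)%E](_ : _ = P setT)// probability_setT mule1.
Qed.

(** Markov's inequality. *)
Lemma prob_ge_le (g : T -> R) (c M : R) : 0 < c -> measurable_fun setT g ->
  (forall w, 0 <= g w) -> (\int[P]_w (g w)%:E <= M%:E)%E ->
  (P [set w | (c <= g w)%R] <= (M / c)%:E)%E.
Proof.
move=> c0 mg g0 gM.
have mA : measurable [set w | c <= g w].
  have -> : [set w | c <= g w] = g @^-1` `[c, +oo[%classic.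
    by apply/seteqP; split=> w /=; rewrite in_itv/= andbT.
  by rewrite -[X in measurable X]setTI; exact: mg.
have mi : measurable_fun setT (fun w => (\1_[set w | c <= g w] w : R)%:E).
  by apply/measurable_EFinP; exact: measurable_indic.
have : ((c%:E * P [set w | (c <= g w)%R]) <= M%:E)%E.
  apply: le_trans gM.
  rewrite -[X in P X]setIT -integral_indic// -ge0_integralZl_EFin ?(ltW c0)//.
  apply: ge0_le_integral => //.
  - by move=> w _; rewrite -EFinM lee_fin mulr_ge0 ?(ltW c0).
  - by apply/measurable_EFinP/measurable_funM => //; exact: measurable_indic.
  - exact/measurable_EFinP.
  - move=> w _; rewrite -EFinM lee_fin indicE.
    by case: (boolP (w \in _)) => [|_]; rewrite ?inE /= ?mulr1 ?mulr0.
have /fineK <- : P [set w | c <= g w] \is a fin_num by exact: fin_num_measure.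
rewrite -EFinM !lee_fin => H.
by rewrite ler_pdivlMr// mulrC.
Qed.

Variable X : nat -> {RV P >-> R}.
Hypothesis indepX : mutually_independent P X.

Lemma adapted_comp A (h : R -> R) i : measurable_fun setT h -> A i ->
  adapted X A (fun w => h (X i w)).
Proof. by move=> mh Ai; apply: (measurableT_comp mh); exact: adapted_RV. Qed.

Lemma adapted_sum A (F : nat -> T -> R) a b :
  (forall i, (a <= i < b)%N -> adapted X A (F i)) ->
  adapted X A (fun w => \sum_(a <= i < b) F i w).
Proof.
move=> FA; rewrite /adapted.
(* [measurable_sum] asks for all summands to be measurable, so those outside the range are replaced
   by 0. *)
have -> : (fun w => \sum_(a <= i < b) F i w) = (fun w =>
    \sum_(i <- index_iota a b) if (a <= i < b)%N then F i w else 0).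
  by apply/funext => w; rewrite -big_mkcond/= big_nat.
apply: measurable_sum => i.
by case: (boolP (_ <= i < _)%N) => [/FA//|_]; exact: measurable_cst.
Qed.

(* Conditionally on the partial sum [u], the linear term of [powR_norm_add]
   integrates to zero. *)
Lemma bahr_esseen (h : R -> R) (r M : R) : 1 < r <= 2 ->
  measurable_fun setT h ->
  (forall i, P.-integrable setT (fun w => (h (X i w))%:E)) ->
  (forall i, (\int[P]_w (h (X i w))%:E = 0)%E) ->
  (forall i, (\int[P]_w (`|h (X i w)| `^ r)%:E <= M%:E)%E) ->
  forall a n, (\int[P]_w (`|\sum_(a <= i < a + n) h (X i w)| `^ r)%:E <=
    (n%:R * (2 `^ (2 - r) * M))%:E)%E.
Proof.
move=> r12 mh inth inth0 hM a; have /andP[r1 r2] := r12.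
have mhX i : measurable_fun setT (fun w => h (X i w)) by exact: measurableT_comp.
have ihr i : P.-integrable setT (fun w => (`|h (X i w)| `^ r)%:E).
  apply/integrableP; split.
    by apply/measurable_EFinP; exact: measurable_normpowR.
  under eq_integral do rewrite gee0_abs ?lee_fin ?powR_ge0//.
  by apply: (le_lt_trans (hM i)); rewrite ltry.
elim=> [|n IHn].
  rewrite addn0 mul0r.
  under eq_integral do rewrite big_geq// normr0 powR0 ?lt0r_neq0 ?(lt_trans ltr01)//.
  by rewrite integral0.
rewrite addnS.
under eq_integral do rewrite big_nat_recr ?leq_addr//=.
pose U w := \sum_(a <= i < a + n) h (X i w).
pose V w := h (X (a + n) w).
have mU : adapted X [set i | (i < a + n)%N] U.
  by apply: adapted_sum => i /andP[_ ilt]; exact: adapted_comp.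
have mV : adapted X [set (a + n)%N] V by apply: adapted_comp.
have mU' := adapted_measurable mU; have mV' := adapted_measurable mV.
have mf : measurable_fun setT (fun x : R * R => (`|x.1 + x.2| `^ r)%:E).
  apply/measurable_EFinP; apply: (measurableT_comp (measurable_powR r)).
  by apply: measurableT_comp => //; apply: measurable_funD.
have AB : [set i | (i < a + n)%N] `&` [set (a + n)%N] = set0.
  by apply/seteqP; split=> // i /= [+ ie]; rewrite ie ltnn.
have f0 (x : R * R) : (0 <= (`|x.1 + x.2| `^ r)%:E)%E by rewrite lee_fin powR_ge0.
rewrite (indep_integral indepX AB mU mV mf f0)/=.
have inner u : (\int[P]_v (`|u + V v| `^ r)%:E <= (`|u| `^ r + 2 `^ (2 - r) * M)%:E)%E.
  pose c := r * (Num.sg u * `|u| `^ (r - 1)).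
  apply: (@le_trans _ _ (\int[P]_v ((`|u| `^ r)%:E + (c%:E * (V v)%:E +
     (2 `^ (2 - r))%:E * (`|V v| `^ r)%:E)))%E).
    apply: ge0_le_integral => //.
    - by apply/measurable_EFinP/measurable_normpowR; apply: measurable_funD.
    - apply: emeasurable_funD => //; apply: emeasurable_funD.
        by apply/measurable_EFinP; exact: measurable_funM.
      apply/measurable_EFinP; apply: measurable_funM => //.
      exact: measurable_normpowR.
    - move=> v _; rewrite -!EFinM -!EFinD lee_fin addrA.
      exact: powR_norm_add.
  have i1 : P.-integrable setT (fun=> (`|u| `^ r)%:E).
    exact: finite_measure_integrable_cst.
  have i2 : P.-integrable setT (fun v => (c%:E * (V v)%:E)%E).
    apply: (integrableZl measurableT); exact: inth.
  have i3 : P.-integrable setT (fun v => ((2 `^ (2 - r))%:E * (`|V v| `^ r)%:E)%E).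
    apply: (integrableZl measurableT); exact: ihr.
  rewrite integralD//; last exact: integrableD.
  rewrite integralD// (integralZl measurableT (inth _)) inth0 mule0 add0e.
  rewrite (integralZl measurableT (ihr _)).
  rewrite integral_cst_prob.
  by rewrite EFinD leeD2l// EFinM lee_pmul2l ?lte_fin ?powR_gt0.
apply: (@le_trans _ _ (\int[P]_w (`|U w| `^ r + 2 `^ (2 - r) * M)%:E)%E).
  apply: ge0_le_integral => //.
  - by move=> w _; apply: integral_ge0 => v _; rewrite lee_fin powR_ge0.
  - have -> : (fun w => \int[P]_v (`|U w + V v| `^ r)%:E)%E =
      (fun u => \int[P]_v (`|u + V v| `^ r)%:E)%E \o U by [].
    apply: measurableT_comp; last exact: adapted_measurable mU.
    pose g (x : R * T) := (`|x.1 + V x.2| `^ r)%:E.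
    apply: (@measurable_fun_fubini_tonelli_F _ _ _ _ _ P g).
    + apply/measurable_EFinP; apply: (measurableT_comp (measurable_powR r)).
      apply: measurableT_comp => //; apply: measurable_funD => //.
      exact: (measurableT_comp (adapted_measurable mV) measurable_snd).
    + by move=> x; rewrite lee_fin powR_ge0.
  - apply/measurable_EFinP; apply: measurable_funD => //; apply: measurable_normpowR.
    exact: adapted_measurable mU.
under eq_integral do rewrite EFinD.
have M0 : 0 <= M.
  rewrite -lee_fin; apply: le_trans (hM 0%N).
  by apply: integral_ge0 => w _; rewrite lee_fin powR_ge0.
rewrite ge0_integralD//.
- rewrite integral_cst_prob.
  by rewrite -(natr1 n) mulrDl mul1r EFinD leeD2r.
- by apply/measurable_EFinP/measurable_normpowR; exact: adapted_measurable mU.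
- by move=> w _; rewrite lee_fin mulr_ge0 ?powR_ge0.
Qed.

End Moments.

(** * Medians and majorities *)

Section OrderStatistics.
Variable R : realType.
Implicit Types (s : seq R) (p : pred R).

(** In a sorted sequence an upward closed predicate holds on a final segment, so it holds at index i
    exactly if that segment has at least [size s - i] entries. *)
Lemma sort_count_up p s i : (forall x y, x <= y -> p x -> p y) ->
  (i < size s)%N -> p (nth 0 (sort <=%R s) i) = (size s - i <= count p s)%N.
Proof.
move=> pup ilt.
have /permP <- : perm_eq (sort <=%R s) s by rewrite perm_sort.
rewrite -(size_sort <=%R s) in ilt *.
have : sorted <=%R (sort <=%R s) := sort_sorted le_total s.
move: (sort <=%R s) ilt => u iu su.
have nth_le j k : (j <= k)%N -> (k < size u)%N -> nth 0 u j <= nth 0 u k.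
  move=> jk ku; apply: (sorted_leq_nth le_trans le_refl) => //.
  by rewrite inE (leq_ltn_trans jk).
case: (boolP (p (nth 0 u i))) => [pi|npi].
  apply/esym; rewrite -[in count _ _](cat_take_drop i u) count_cat -size_drop.
  suff /eqP -> : count p (drop i u) == size (drop i u) by rewrite leq_addl.
  rewrite -all_count; apply/(all_nthP 0) => j; rewrite size_drop ltn_subRL => ij.
  by rewrite nth_drop; apply: pup pi; rewrite nth_le ?leq_addr.
apply/esym/negbTE; rewrite -ltnNge.
rewrite -[in count _ _](cat_take_drop i.+1 u) count_cat.
suff -> : count p (take i.+1 u) = 0%N.
  rewrite add0n (leq_ltn_trans (count_size _ _))// size_drop.
  by rewrite ltn_sub2l.
apply/eqP; rewrite -leqn0 leqNgt -has_count; apply/(has_nthP 0) => -[j].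
rewrite size_takel// => ji; rewrite nth_take// => pj.
by move/negP: npi; apply; apply: pup pj; rewrite nth_le.
Qed.

Lemma median_up p s : (forall x y, x <= y -> p x -> p y) -> odd (size s) ->
  p (median s) = ((size s)./2 < count p s)%N.
Proof.
move=> pup os; have sE := odd_double_half (size s); rewrite os in sE.
rewrite /median sort_count_up//; last by rewrite -[ltnRHS]sE -addnn ltnS leq_addr.
by congr (_ <= _)%N; lia.
Qed.

(** The complement of [p] is upward closed, and for odd size exactly one of [p] and its complement
    holds for a majority. *)
Lemma median_down p s : (forall x y, x <= y -> p y -> p x) -> odd (size s) ->
  p (median s) = ((size s)./2 < count p s)%N.
Proof.
move=> pdn os; have sE := odd_double_half (size s); rewrite os in sE.
have := @median_up (predC p) s _ os; rewrite /= -/(predC p) => H.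
rewrite -[LHS]negbK H; last by move=> x y xy; apply: contra; exact: pdn.
have := count_predC p s; lia.
Qed.

(** An equality of booleans, so that events about a median can be rewritten as events about the
    number of blocks with a property. *)
Lemma median_map_majority (p : pred R) (f : nat -> R) n : odd n ->
  (forall x y, x <= y -> p x -> p y) \/ (forall x y, x <= y -> p y -> p x) ->
  p (median [seq f l | l <- iota 0 n]) =
  (n./2 < count (fun l => p (f l)) (iota 0 n))%N.
Proof.
move=> on [pup|pdn]; [rewrite (median_up pup)|rewrite (median_down pdn)];
  by rewrite ?count_map ?size_map ?size_iota.
Qed.

End OrderStatistics.

(* The number of subsets of an [n]-element set with at least [j] elements. *)
Fixpoint subsets_geq (n j : nat) : nat :=
  match j, n with
  | 0, _ => 2 ^ n
  | _.+1, 0 => 0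
  | j'.+1, n'.+1 => subsets_geq n' j' + subsets_geq n' j
  end.

Lemma subsets_geq0 n j : (n < j)%N -> subsets_geq n j = 0%N.
Proof.
elim: n j => [|n IHn] [|j]//= nj.
by rewrite !IHn// ltnW.
Qed.

(** Complementation maps the subsets with at least n + 1 - j elements onto those with fewer than j.
    For an odd set and j just above the middle this says that half of all subsets are majorities. *)
Lemma subsets_geq_compl n j : (j <= n.+1)%N ->
  (subsets_geq n j + subsets_geq n (n.+1 - j) = 2 ^ n)%N.
Proof.
elim: n j => [|n IHn] [|j]; rewrite ?[subsets_geq _ 0]/=.
- by [].
- by case: j.
- by rewrite subn0 subsets_geq0 ?addn0.
rewrite ltnS => jn; rewrite subSS.
have [jE|jn1] := eqVneq j n.+1.
  by rewrite jE subnn subsets_geq0.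
have {}jn : (j <= n)%N by lia.
rewrite subSn// [subsets_geq n.+1 j.+1]/= [subsets_geq n.+1 _.+1]/=.
have := IHn j ltac:(lia); have := IHn j.+1 ltac:(lia).
rewrite subSS subSn// expnS; lia.
Qed.

Lemma subsets_geq_majority n : subsets_geq n.*2.+1 n.+1 = (4 ^ n)%N.
Proof.
have := @subsets_geq_compl n.*2.+1 n.+1 ltac:(lia).
have -> : (n.*2.+2 - n.+1 = n.+1)%N by lia.
have -> : (2 ^ n.*2.+1 = 2 * 4 ^ n)%N by rewrite expnS -mul2n expnM.
lia.
Qed.

(** * Majorities and symmetric polynomials of independent blocks *)

Section EventsAlgebra.
Context d (T : measurableType d) (R : realType) (P : probability T R).
Variables (X : nat -> {RV P >-> R}) (S : set nat).

Lemma events_setT : events X S setT.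
Proof. exact: (@measurableT _ (g_sigma_algebraType (cylinders X S))). Qed.

Lemma events_set0 : events X S set0.
Proof. exact: (@measurable0 _ (g_sigma_algebraType (cylinders X S))). Qed.

Lemma events_setI E F : events X S E -> events X S F -> events X S (E `&` F).
Proof. exact: (@measurableI _ (g_sigma_algebraType (cylinders X S))). Qed.

Lemma events_setU E F : events X S E -> events X S F -> events X S (E `|` F).
Proof. exact: (@measurableU _ (g_sigma_algebraType (cylinders X S))). Qed.

Lemma events_setC E : events X S E -> events X S (~` E).
Proof. exact: (@measurableC _ (g_sigma_algebraType (cylinders X S))). Qed.

End EventsAlgebra.

Lemma count_iotaS (p : pred nat) n :
  count p (iota 0 n.+1) = (count p (iota 0 n) + p n)%N.
Proof. by rewrite -addn1 iotaD count_cat /= addn0. Qed.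

(** The recursion asks whether the last index is chosen. That index belongs to the newest block,
    which is independent of everything in the remaining factors. *)
Fixpoint elem_sym (R : realType) (f : nat -> R) (n j : nat) : R :=
  match j, n with
  | 0, _ => 1
  | _.+1, 0 => 0
  | j'.+1, n'.+1 => elem_sym f n' j + f n' * elem_sym f n' j'
  end.

Lemma elem_sym_ge0 (R : realType) (f : nat -> R) n j :
  (forall l, 0 <= f l) -> 0 <= elem_sym f n j.
Proof.
by move=> f0; elim: n j => [|n IHn] [|j]//=; rewrite addr_ge0 ?mulr_ge0.
Qed.

(** If j of the values are at least t, their product is a monomial that is at least t^j, and the
    other monomials are nonnegative. *)
Lemma exprn_le_elem_sym (R : realType) (f : nat -> R) (t : R) n j :
  (forall l, 0 <= f l) -> 0 <= t ->
  (j <= count (fun l => (t <= f l)%R) (iota 0 n))%N -> t ^+ j <= elem_sym f n j.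
Proof.
move=> f0 t0; elim: n j => [|n IHn] [|j]//.
rewrite count_iotaS [elem_sym _ _ _]/=.
case: leP => [tf|_]; last first.
  rewrite addn0 => /IHn/le_trans; apply.
  by rewrite lerDl mulr_ge0// elem_sym_ge0.
rewrite addn1 ltnS => /IHn H; rewrite exprS.
apply: (@le_trans _ _ (f n * elem_sym f n j)); last by rewrite lerDr elem_sym_ge0.
by rewrite ler_pM// exprn_ge0.
Qed.

Section IndependentBlocks.
Context d (T : measurableType d) (R : realType) (P : probability T R).
Variable X : nat -> {RV P >-> R}.
Hypothesis indepX : mutually_independent P X.
Variable A : nat -> set nat.
Hypothesis disjA : forall i j, i != j -> A i `&` A j = set0.

Let past n := \bigcup_(l in `I_n) A l.

Let past_disj n : A n `&` past n = set0.
Proof.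
apply/seteqP; split=> // i [Ani [l /= ln Ali]].
have nl : n != l by rewrite gtn_eqF.
by have : (A n `&` A l) i by []; rewrite disjA.
Qed.

Let pastS n : past n `<=` past n.+1.
Proof. by move=> i [l /= ln Ali]; exists l => //=; exact: ltnW. Qed.

Let past_last n : A n `<=` past n.+1.
Proof. by move=> i Ani; exists n => /=. Qed.

Section Counting.
Variable b : nat -> T -> bool.
Hypothesis bA : forall l, events X (A l) [set w | b l w].

Let atleast n j := [set w | (j <= count (fun l => b l w) (iota 0 n))%N].

Let atleastS n j : atleast n.+1 j.+1 =
  ([set w | b n w] `&` atleast n j) `|` (~` [set w | b n w] `&` atleast n j.+1).
Proof.
rewrite /atleast; under eq_set => w.
  rewrite count_iotaS; over.
apply/seteqP; split => w /=.
  by case: (b n w) => /=; rewrite ?addn1 ?addn0 => H; [left|right].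
by case: (b n w) => -[[]|[]]//=; rewrite ?addn1 ?addn0.
Qed.

Let events_atleast n j : events X (past n) (atleast n j).
Proof.
elim: n j => [|n IHn] [|j].
- rewrite (_ : atleast _ _ = setT); first exact: events_setT.
  by apply/seteqP; split.
- rewrite (_ : atleast _ _ = set0); first exact: events_set0.
  by apply/seteqP; split.
- rewrite (_ : atleast _ _ = setT); first exact: events_setT.
  by apply/seteqP; split.
have bn := sub_events (@past_last n) (@bA n).
rewrite atleastS; apply: events_setU; apply: events_setI => //.
- exact: (sub_events (@pastS n)).
- exact: events_setC.
- exact: (sub_events (@pastS n)).
Qed.

Lemma events_majority n j :
  events X (\bigcup_(l in `I_n) A l)
    [set w | (j <= count (fun l => b l w) (iota 0 n))%N].
Proof. exact: events_atleast. Qed.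

Hypothesis b_prob : forall l, (P [set w | b l w] <= (4^-1)%:E)%E.

(* Comparing with [subsets_geq] tilts each coin from (1/4, 3/4) to (1/2, 1/2);
   this gains the factor 2 over the exponential-moment bound. *)
Let prob_atleast n j :
  (P (atleast n j) <= ((3 / 4) ^+ n * 3 ^- j * (subsets_geq n j)%:R)%:E)%E.
Proof.
have le1 m : (P (atleast m 0) <= ((3 / 4) ^+ m * 3 ^- 0 * (subsets_geq m 0)%:R)%:E)%E.
  apply: (@le_trans _ _ 1%E); first by apply: probability_le1; exact: events_measurable (@events_atleast m 0).
  rewrite lee_fin expr0 invr1 mulr1; have -> : subsets_geq m 0 = (2 ^ m)%N by case: m.
  by rewrite natrX -exprMn exprn_ege1//; lra.
elim: n j => [|n IHn] [|j]; [exact: le1| |exact: le1|].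
  rewrite (_ : atleast _ _ = set0) ?measure0 ?lee_fin ?mulr_ge0//.
  by apply/seteqP; split.
pose B := [set w | b n w].
have mB : measurable B := events_measurable (@bA n).
have mC m i := events_measurable (@events_atleast m i).
have -> : P (atleast n.+1 j.+1) =
    (P B * P (atleast n j) + P (~` B) * P (atleast n j.+1))%E.
  rewrite atleastS measureU.
  - by congr (_ + _)%E; apply: (events_indep indepX (@past_disj n)) => //;
      apply: events_setC.
  - exact: measurableI.
  - by apply: measurableI => //; exact: measurableC.
  - by rewrite setIACA setICr set0I.
rewrite probability_setC//.
have finP E : measurable E -> P E = (fine (P E))%:E.
  by move=> mE; rewrite fineK// fin_num_measure.
have := b_prob n; have := IHn j; have := IHn j.+1; rewrite -/B.
(* This monotonicity makes the recursion increasing in [P B], so that [P B] may be replaced by its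
   bound 1/4. *)
have : (P (atleast n j.+1) <= P (atleast n j))%E.
  by apply: le_measure; rewrite ?inE// => w; exact: ltnW.
have := probability_le1 P mB.
rewrite (finP _ mB) (finP _ (mC n j)) (finP _ (mC n j.+1)).
rewrite -EFinB -!EFinM -EFinD !lee_fin.
rewrite !exprS invfM natrD.
have : 0 <= fine (P B) by exact: fine_ge0.
move: (fine (P B)) (fine (P (atleast n j))) (fine (P (atleast n j.+1))) => x y z.
move: ((3 / 4) ^+ n) (3 ^- j) ((subsets_geq n j)%:R) ((subsets_geq n j.+1)%:R) => u v s t.
move=> x0 x1 zy Hz Hy Hx.
have -> : 3 / 4 * u * (3^-1 * v) * (s + t) = 4^-1 * (u * v * s) + 3 / 4 * (u * (3^-1 * v) * t).
  by field.
nra.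
Qed.

(** With 2n+1 blocks and threshold n+1 the number of subsets is 4^n, and (3/4)^(2n+1) 3^-(n+1) 4^n
    equals the stated bound. *)
Lemma prob_majority n :
  (P [set w | (n < count (fun l => b l w) (iota 0 n.*2.+1))%N] <=
   (4^-1 * (3 / 4) ^+ n)%:E)%E.
Proof.
apply: (le_trans (prob_atleast n.*2.+1 n.+1)); rewrite lee_fin subsets_geq_majority.
rewrite le_eqVlt; apply/orP; left; apply/eqP.
rewrite natrX !exprS -mul2n exprM.
have -> : ((3 / 4) ^+ 2 = (3 / 4) * 3 * 4^-1 :> R) by field.
rewrite !exprMn !exprVn; field.
by rewrite !expf_neq0.
Qed.

End Counting.

Section ElementarySymmetric.
Variables (f : nat -> T -> R) (M : R).
Hypothesis f0 : forall l w, 0 <= f l w.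
Hypothesis fA : forall l, adapted X (A l) (f l).
Hypothesis fM : forall l, (\int[P]_w (f l w)%:E <= M%:E)%E.

Lemma adapted_elem_sym n j : adapted X (past n) (fun w => elem_sym (f^~ w) n j).
Proof.
elim: n j => [|n IHn] [|j]; rewrite /adapted /=; try exact: measurable_cst.
apply: measurable_funD; first by apply: (adapted_sub (@pastS n)); exact: IHn.
apply: measurable_funM; first by apply: (adapted_sub (@past_last n)).
by apply: (adapted_sub (@pastS n)); exact: IHn.
Qed.

(** Every monomial is a product of j independent factors of mean at most M; the recursion of
    [elem_sym] turns into Pascal's rule for their number. *)
Lemma integral_elem_sym n j :
  (\int[P]_w (elem_sym (f^~ w) n j)%:E <= ('C(n, j)%:R * M ^+ j)%:E)%E.
Proof.
have M0 : 0 <= M.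
  rewrite -lee_fin; apply: le_trans (fM 0%N).
  by apply: integral_ge0 => w _; rewrite lee_fin.
have cst1 : (\int[P]_w (1:R)%:E = 1)%E.
  exact: integral_cst_prob.
have es0 m i w : 0 <= elem_sym (f^~ w) m i by exact: elem_sym_ge0.
elim: n j => [|n IHn] [|j].
- by rewrite [X in (X <= _)%E]cst1 lee_fin bin0 mul1r.
- under eq_integral do rewrite /=.
  by rewrite integral0 lee_fin mulr_ge0// exprn_ge0.
- by rewrite [X in (X <= _)%E]cst1 lee_fin bin0 mul1r.
have mes m i := adapted_measurable (@adapted_elem_sym m i).
have mf l := adapted_measurable (@fA l).
under eq_integral do rewrite /= EFinD.
rewrite ge0_integralD//; last 4 first.
- by move=> w _; rewrite lee_fin.
- exact/measurable_EFinP.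
- by move=> w _; rewrite lee_fin mulr_ge0.
- by apply/measurable_EFinP; exact: measurable_funM.
rewrite binS natrD mulrDl EFinD leeD//.
(* [indep_integral] wants a function that is nonnegative on the whole plane; the absolute values
   disappear on the nonnegative arguments. *)
pose g (x : R * R) := (`|x.1| * `|x.2|)%:E.
have mg : measurable_fun setT g.
  by apply/measurable_EFinP; apply: measurable_funM; apply: measurableT_comp.
have g0 x : (0 <= g x)%E by rewrite lee_fin mulr_ge0.
pose I := (\int[P]_v (elem_sym (f^~ v) n j)%:E)%E.
have I0 : (0 <= I)%E by apply: integral_ge0 => v _; rewrite lee_fin.
have -> : (\int[P]_w (f n w * elem_sym (f^~ w) n j)%:E =
           \int[P]_w ((f n w)%:E * I))%E.
  transitivity (\int[P]_w g (f n w, elem_sym (f^~ w) n j))%E.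
    by apply: eq_integral => w _; rewrite /g /= !ger0_norm.
  rewrite (indep_integral indepX (@past_disj n) (@fA n) (@adapted_elem_sym n j) mg g0).
  apply: eq_integral => w _; rewrite -ge0_integralZl_EFin//.
  - by apply: eq_integral => v _; rewrite /g /= !ger0_norm.
  - by move=> v _; rewrite lee_fin.
  - exact/measurable_EFinP.
rewrite ge0_integralZr//; last 2 first.
- exact/measurable_EFinP.
- by move=> w _; rewrite lee_fin.
rewrite exprS mulrCA EFinM; apply: lee_pmul => //.
  by apply: integral_ge0 => v _; rewrite lee_fin.
exact: IHn.
Qed.

End ElementarySymmetric.

End IndependentBlocks.

(** * Interpolation of moments *)

Section Interpolation.
Context d (T : measurableType d) (R : realType) (P : probability T R).
Variable X : T -> R.
Hypothesis mX : measurable_fun setT X.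

Lemma Lnorm_moment (t b : R) : 0 < t -> (\int[P]_w (`|X w| `^ t)%:E = b%:E)%E ->
  ('N[P]_t%:E[EFin \o X] = (b `^ t^-1)%:E)%E.
Proof.
move=> t0 bE; rewrite unlock.
have -> : (\int[P]_w (`|(EFin \o X) w| `^ t) = b%:E)%E.
  by rewrite -bE; apply: eq_integral => w _; rewrite ?poweR_EFin.
by rewrite poweR_EFin.
Qed.

Lemma moment_ge0 (t b : R) : (\int[P]_w (`|X w| `^ t)%:E = b%:E)%E -> 0 <= b.
Proof.
move=> bE; rewrite -lee_fin -bE.
by apply: integral_ge0 => w _; rewrite lee_fin powR_ge0.
Qed.

(** Hölder's inequality for |X|^(1-v) and |X|^(qv) with exponents 1/(1-v) and 1/v. The values v = 0
    and v = 1, where an exponent is infinite, are immediate. *)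
Lemma lyapunov (q a b t v : R) : 1 < q ->
  (\int[P]_w (`|X w|)%:E = a%:E)%E -> (\int[P]_w (`|X w| `^ q)%:E = b%:E)%E ->
  0 <= v <= 1 -> t = 1 - v + q * v ->
  (\int[P]_w (`|X w| `^ t)%:E <= (a `^ (1 - v) * b `^ v)%:E)%E.
Proof.
move=> q1 aE bE /andP[v0 v1] tE.
have b0 := moment_ge0 bE.
have a0 : 0 <= a by rewrite -lee_fin -aE; apply: integral_ge0 => w _; rewrite lee_fin.
have [v00|vn0] := eqVneq v 0.
  rewrite tE v00 subr0 mulr0 addr0 powRr0 mulr1 powRr1//.
  by under eq_integral do rewrite powRr1//; rewrite aE.
have [v11|vn1] := eqVneq v 1.
  by rewrite tE v11 subrr add0r mulr1 powRr0 mul1r powRr1// bE.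
have vp : 0 < v by rewrite lt_neqAle eq_sym vn0.
have vp' : 0 < 1 - v by rewrite subr_gt0 lt_neqAle vn1.
pose f w := `|X w| `^ (1 - v).
pose g w := `|X w| `^ (q * v).
have mf : measurable_fun setT f by exact: measurable_normpowR.
have mg : measurable_fun setT g by exact: measurable_normpowR.
have f0 w : 0 <= f w by exact: powR_ge0.
have g0 w : 0 <= g w by exact: powR_ge0.
have := @hoelder _ T R P f g (1 - v)^-1 v^-1 mf mg.
rewrite !invr_gt0 !invrK subrK => /(_ vp' vp erefl).
rewrite Lnorm1.
rewrite (eq_integral (fun w => (`|X w| `^ t)%:E)); last first.
  move=> w _; rewrite /= ger0_norm ?mulr_ge0//.
  rewrite /f /g -powRD -?tE//; apply/implyP => /eqP; nra.
rewrite unlock !invrK.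
have -> : (\int[P]_w (`|(EFin \o f) w| `^ (1 - v)^-1) = a%:E)%E.
  rewrite -aE; apply: eq_integral => w _.
  rewrite /= ger0_norm//.
  by rewrite /f -powRrM mulfV ?lt0r_neq0// powRr1.
have -> : (\int[P]_w (`|(EFin \o g) w| `^ v^-1) = b%:E)%E.
  rewrite -bE; apply: eq_integral => w _.
  rewrite /= ger0_norm//.
  by rewrite /g -powRrM mulfK// lt0r_neq0.
by rewrite !poweR_EFin -EFinM.
Qed.

End Interpolation.

(** Here a stands for E|X| and N for the q-norm of X. The hypothesis is the ratio condition with the
    p-norm already interpolated between orders 1 and q; it is solved for N and inserted into the
    interpolation at order r. The exponent pq/(q-p) arises as q/((q-1) th). *)
Lemma interpolation_exponents (R : realType) (p q r K a N : R) :
  1 <= p -> p < q -> 1 < r <= q -> 1 < K -> 0 <= a -> 0 <= N ->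
  N <= K * (a `^ (1 - (p - 1) / (q - 1)) * (N `^ q) `^ ((p - 1) / (q - 1))) `^ p^-1 ->
  a `^ (1 - (r - 1) / (q - 1)) * (N `^ q) `^ ((r - 1) / (q - 1)) <=
  (K `^ (p * q / (q - p))) `^ (r - 1) * a `^ r.
Proof.
move=> p1 pq /andP[r1 rq] K1 a0 N0 H.
set u := (p - 1) / (q - 1) in H *; set v := (r - 1) / (q - 1).
have q1 : 0 < q - 1 by lra.
have qp : 0 < q - p by lra.
have p0 : 0 < p by lra.
have v0 : 0 < v by rewrite divr_gt0//; lra.
have K0 : 0 <= K by apply: ltW; apply: lt_trans K1.
(* The power N^(1-th) is what the hypothesis carries on its right side; dividing by it leaves N^th
   <= K a^th. *)
pose th := (1 - u) / p.
have thE : th = (q - p) / (p * (q - 1)).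
  by rewrite /th /u; field; rewrite !lt0r_neq0.
have th0 : 0 < th by rewrite thE divr_gt0 ?mulr_gt0.
have NK : N <= K `^ th^-1 * a.
  move: N0; rewrite le_eqVlt => /predU1P[<-|N0]; first by rewrite mulr_ge0 ?powR_ge0.
  have nu0 : 0 < N `^ (1 - th) by rewrite powR_gt0.
  have : N `^ th <= K * a `^ th.
    rewrite -(ler_pM2r nu0) -powRD; last by rewrite (gt_eqF N0) implybT.
    rewrite addrC subrK powRr1 ?(ltW N0)//; apply: (le_trans H).
    rewrite powRM ?powR_ge0// -[(a `^ _) `^ _]powRrM -/th mulrA.
    have -> // : ((N `^ q) `^ u) `^ p^-1 = N `^ (1 - th).
    rewrite -!powRrM; congr (_ `^ _).
    by rewrite thE /u; field; rewrite !lt0r_neq0.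
  have ith : 0 <= th^-1 by rewrite invr_ge0 ltW.
  move=> /(ge0_ler_powR ith); rewrite !nnegrE powR_ge0 mulr_ge0 ?powR_ge0//.
  move=> /(_ isT isT); rewrite powRM ?powR_ge0// -!powRrM mulfV ?lt0r_neq0//.
  by rewrite !powRr1// ltW.
have qv0 : 0 <= q * v by rewrite mulr_ge0; lra.
rewrite -[(N `^ q) `^ v]powRrM.
apply: (@le_trans _ _ (a `^ (1 - v) * (K `^ th^-1 * a) `^ (q * v))).
  rewrite ler_wpM2l ?powR_ge0//.
  by apply: ge0_ler_powR => //; rewrite nnegrE// mulr_ge0 ?powR_ge0.
rewrite powRM ?powR_ge0// mulrCA -powRD; last first.
  apply/implyP => /eqP; have : v <= 1 by rewrite ler_pdivrMr//; lra.
  by nra.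
have -> : 1 - v + q * v = r by rewrite /v; field; rewrite lt0r_neq0.
rewrite -!powRrM.
have -> // : th^-1 * (q * v) = p * q / (q - p) * (r - 1).
by rewrite thE /v; field; rewrite !lt0r_neq0.
Qed.

(* min(q, 2) *)
Definition moment_order (R : realType) (q : \bar R) : R :=
  if (q <= 2%:E)%E then fine q else 2.

(** * Moment bounds for members of the norm-ratio class *)

Section NormRatioClass.
Context d (T : measurableType d) (R : realType) (P : probability T R).
Variables (p : R) (q : \bar R) (K : R) (Y : {RV P >-> R}).
Hypotheses (p_ge1 : 1 <= p) (p_lt_q : (p%:E < q)%E) (q_gt1 : (1%:E < q)%E)
  (K_gt1 : 1 < K) (YF : norm_ratio_class P p q K Y).

Let X := fun w => Y w - mean P Y.
Let rho := fine (centered_norm P 1%:E Y).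

Lemma class_integrable : P.-integrable setT (EFin \o Y).
Proof.
apply/Lfun1_integrable; case: YF => YL _.
apply: (@Lfun_subset _ T R P 1%:E q _ _ _ _ Y YL) => //.
- exact: ltW.
- by rewrite fin_num_measure.
- exact: ltW.
Qed.

Lemma centered_measurable : measurable_fun setT X.
Proof. by apply: measurable_funB. Qed.

Lemma centered_integrable : P.-integrable setT (EFin \o X).
Proof.
have := integrableB measurableT class_integrable (finite_measure_integrable_cst P (mean P Y) measurableT).
exact.
Qed.

Lemma centered_mean : (\int[P]_w (Y w - mean P Y)%:E = 0)%E.
Proof.
under eq_integral do rewrite EFinB.
rewrite (integralB measurableT class_integrable
  (finite_measure_integrable_cst P (mean P Y) measurableT)).
rewrite integral_cst_prob /mean unlock fineK ?subee//.
- exact: integrable_fin_num class_integrable.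
- exact: integrable_fin_num class_integrable.
Qed.

Lemma centered_abs_moment :
  (\int[P]_w (`|Y w - mean P Y|)%:E = (fine (centered_norm P 1%:E Y))%:E)%E.
Proof.
have H : (\int[P]_w (`|X w|)%:E)%E \is a fin_num.
  have /integrable_abse := centered_integrable.
  by move=> /(integrable_fin_num measurableT).
by rewrite /centered_norm Lnorm1 fineK.
Qed.

Lemma class_moment :
  (\int[P]_w (`|Y w - mean P Y| `^ moment_order q)%:E <=
   ((K `^ ratio_exponent p q) `^ (moment_order q - 1) *
    fine (centered_norm P 1%:E Y) `^ moment_order q)%:E)%E.
Proof.
rewrite -/rho; have rho0 : 0 <= rho.
  by rewrite -lee_fin -centered_abs_moment; apply: integral_ge0 => w _; rewrite lee_fin.
have p0 : 0 < p by exact: lt_le_trans p_ge1.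
have K0 : 0 <= K by apply: ltW; apply: lt_trans K_gt1.
have mX := centered_measurable.
have moment_fin t : 1 <= t -> (Y : T -> R) \in Lfun P t%:E ->
    (\int[P]_w (`|X w| `^ t)%:E \is a fin_num)%E.
  move=> t1 Yt.
  have Xt : X \in Lfun P t%:E.
    have t1' : (1 <= t%:E)%E by rewrite lee_fin.
    have := (Lfun_addr_closed P t1').2 _ _ Yt (Lfun_cst P (- mean P Y) t).
    exact.
  have := Lfun_integrable t1 Xt.
  by move=> /(integrable_fin_num measurableT).
have [YL Yratio] := YF.
have YLp : (Y : T -> R) \in Lfun P p%:E.
  apply: (@Lfun_subset _ T R P p%:E q _ _ _ _ Y YL) => //.
  - by rewrite ltW.
  - by rewrite fin_num_measure.
  - exact: ltW.
have bpE := esym (fineK (moment_fin p p_ge1 YLp)).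
move: Yratio; rewrite /centered_norm (Lnorm_moment p0 bpE).
have bp0 := moment_ge0 bpE.
move: bpE bp0; set bp := fine _ => bpE bp0.
move: p_lt_q q_gt1 YL; rewrite /ratio_exponent /moment_order.
case: q => [r|_ _ _ |//]; last first.
- rewrite leye_eq/= unlock ifT => [supM|]; last first.
    by rewrite [X in (_ < X)%E](@probability_setT _ _ _ P) lte01.
  (* For q = +oo the ratio condition bounds |X| almost everywhere by this M, and E|X|^t <= M^(t-1)
     E|X| takes the place of interpolation. *)
  pose M := K * bp `^ p^-1.
  have M0 : 0 <= M by rewrite mulr_ge0 ?powR_ge0.
  have XM : {ae P, forall w, `|X w| <= M}.
    have := ess_sup_ge P (abse \o (EFin \o X)).
    apply: filterS => w /= H.
    by rewrite -lee_fin; apply: (le_trans H); rewrite -EFinM in supM.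
  have powM t : 1 <= t -> (\int[P]_w (`|X w| `^ t)%:E <= (M `^ (t - 1) * rho)%:E)%E.
    move=> t1.
    have mabs : measurable_fun setT (fun w => (`|X w|)%:E).
      by apply/measurable_EFinP; exact: measurableT_comp.
    have <- : (\int[P]_w ((M `^ (t - 1))%:E * (`|X w|)%:E) = (M `^ (t - 1) * rho)%:E)%E.
      rewrite ge0_integralZl_EFin ?powR_ge0 ?centered_abs_moment//.
    apply: ae_ge0_le_integral => //.
    - by apply/measurable_EFinP; exact: measurable_normpowR.
    - by move=> w _; rewrite -EFinM lee_fin mulr_ge0 ?powR_ge0.
    - by apply/measurable_EFinP; apply: measurable_funM => //; exact: measurableT_comp.
    - apply: filterS XM => w XM _; rewrite -EFinM lee_fin.
      rewrite -(@mulr_powRB1 _ `|X w| t)//; last by lra.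
      rewrite mulrC ler_wpM2r// ge0_ler_powR ?nnegrE//; lra.
  (* The case t = p reads M^p = K^p E|X|^p <= K^p M^(p-1) rho, from which M^(p-1) is cancelled. *)
  have MK : M <= K `^ p * rho.
    have := powM p p_ge1; rewrite bpE lee_fin => bpM.
    move: (M0); rewrite le_eqVlt => /predU1P[<-|Mgt0]; first by rewrite mulr_ge0 ?powR_ge0.
    have Mp : 0 < M `^ (p - 1) by rewrite powR_gt0.
    rewrite -(ler_pM2r Mp) mulr_powRB1//.
    rewrite {1}/M powRM ?powR_ge0// -powRrM mulVf ?lt0r_neq0// powRr1//.
    by rewrite -mulrA ler_wpM2l ?powR_ge0// mulrC.
  apply: (le_trans (powM 2 _)); first by lra.
  rewrite lee_fin (_ : 2 - 1 = 1); last by ring.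
  rewrite !powRr1 ?powR_ge0// powR_mulrn// expr2 mulrA.
  by rewrite ler_wpM2r.
- rewrite lte_fin => pr; rewrite lte_fin => r1 YL.
  have r0 : 0 < r by lra.
  have bE := esym (fineK (moment_fin r (ltW r1) YL)).
  rewrite (Lnorm_moment r0 bE) -EFinM lee_fin.
  have b0 := moment_ge0 bE.
  move: bE b0; set b := fine _ => bE b0.
  pose N := b `^ r^-1.
  have N0 : 0 <= N by exact: powR_ge0.
  have bN : b = N `^ r by rewrite /N -powRrM mulVf ?lt0r_neq0// powRr1.
  move=> NK.
  set t := (if _ then _ else _).
  have t12 : 1 < t <= r.
    rewrite /t lee_fin; case: (leP r 2) => [r2|r2] /=; first by apply/andP; split.
    by rewrite ltr1n (ltW r2).
  have vE s : 1 <= s <= r -> 0 <= (s - 1) / (r - 1) <= 1.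
    move=> /andP[s1 sr]; have rr : 0 < r - 1 by rewrite subr_gt0.
    by rewrite divr_ge0 ?(ltW rr) ?subr_ge0//= ler_pdivrMr// mul1r lerD2r.
  have sE s : s = 1 - (s - 1) / (r - 1) + r * ((s - 1) / (r - 1)).
    by field; rewrite subr_eq0 gt_eqF.
  have /andP[t1 tr] := t12.
  apply: (le_trans (lyapunov mX r1 centered_abs_moment bE (vE t _) (sE t))).
    by rewrite tr ltW.
  rewrite lee_fin bN; apply: interpolation_exponents => //.
  (* The p-norm in the ratio condition is interpolated at order p. *)
  apply: (le_trans NK); rewrite ler_wpM2l// ge0_ler_powR ?invr_ge0 ?nnegrE ?mulr_ge0 ?powR_ge0 ?(ltW p0)//.
  rewrite -bN -lee_fin -bpE.
  apply: lyapunov r1 centered_abs_moment bE (vE p _) (sE p) => //.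
  by rewrite p_ge1 ltW.
Qed.

End NormRatioClass.

(** * The adaptive algorithm *)

Section Constants.
Variable R : realType.
Implicit Types r kap rho m eps j : R.

Lemma powR_succ (a u : R) : 0 < a -> a `^ (1 + u) = a * a `^ u.
Proof. by move=> a0; rewrite powRD ?(gt_eqF a0) ?implybT// powRr1 ?ltW. Qed.

Lemma powR2_compl (r : R) : 2 `^ (2 - r) = 2 / 2 `^ (r - 1).
Proof.
rewrite (_ : 2 - r = 1 + - (r - 1)); last by ring.
by rewrite powR_succ// powRN.
Qed.

(** The left side is the Markov numerator for two sums, one of X and one of |X| - rho. With u = r -
    1, cancelling m rho^r leaves (16 2^u + 32) kap^u <= m^u. Both terms are absorbed in 48 3^u
    kap^u, whose u-th root is the prescribed lower bound on m. *)
Lemma stage1_constant (r kap rho m : R) : 1 < r -> 0 <= kap -> 0 <= rho -> 0 < m ->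
  3 * 48 `^ (r - 1)^-1 * kap <= m ->
  2 `^ (r - 1) * (m * (2 `^ (2 - r) * (kap `^ (r - 1) * rho `^ r)) +
    m * (2 `^ (2 - r) * (2 `^ (2 - r) * (kap `^ (r - 1) * rho `^ r)))) <=
  4^-1 * (m * (rho / 2)) `^ r.
Proof.
move=> r1 kap0 rho0 m0 mkap; have u0 : 0 < r - 1 by lra.
rewrite powR2_compl; set u := r - 1 in u0 mkap *.
have rE : r = 1 + u by rewrite /u; ring.
have A0 : 0 < 2 `^ u :> R by rewrite powR_gt0.
have A1 : 1 <= 2 `^ u :> R by apply: powR_ge1; lra.
have AB : 2 `^ u <= 3 `^ u :> R.
  by apply: ge0_ler_powR; rewrite ?nnegrE ?(ltW u0)//; lra.
have mu : 48 * 3 `^ u * kap `^ u <= m `^ u.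
  have -> : 48 * 3 `^ u * kap `^ u = (3 * 48 `^ u^-1 * kap) `^ u.
    rewrite !powRM ?mulr_ge0 ?powR_ge0// -powRrM mulVf ?lt0r_neq0// powRr1//.
    by rewrite [48 * _]mulrC.
  by apply: ge0_ler_powR; rewrite ?nnegrE ?(ltW u0) ?mulr_ge0 ?powR_ge0 ?(ltW m0).
have -> : (m * (rho / 2)) `^ r = m * m `^ u * (rho `^ r / (2 * 2 `^ u)).
  have i2 : (2^-1 : R) `^ r = (2 * 2 `^ u)^-1.
    rewrite -powR_succ// -rE -[in RHS]powRN -[2^-1]powR_inv1// -powRrM.
    by rewrite mulN1r.
  rewrite !powRM ?divr_ge0 ?(ltW m0) ?invr_ge0//.
  by rewrite i2 {1}rE powR_succ.
move: (powR_ge0 kap u) (powR_ge0 rho r) mu AB A0 A1.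
move: (2 `^ u) (3 `^ u) (kap `^ u) (m `^ u) (rho `^ r) => A B k n p k0 p0 mu AB A0 A1.
have -> : A * (m * (2 / A * (k * p)) + m * (2 / A * (2 / A * (k * p)))) =
   (m * p / A / 8) * (16 * A * k + 32 * k).
  by field; rewrite gt_eqF.
have -> : 4^-1 * (m * n * (p / (2 * A))) = (m * p / A / 8) * n.
  by field; rewrite gt_eqF.
rewrite ler_wpM2l ?divr_ge0 ?mulr_ge0 ?(ltW A0) ?(ltW m0)//.
apply: le_trans mu.
have : k * A <= k * B by rewrite ler_wpM2l.
have : k <= k * B by rewrite ler_peMr//; lra.
lra.
Qed.

(** The hypothesis raised to the power r - 1 is the claim up to common factors, with no slack: (1 +
    1/(r-1)) (r-1) = r, and 16 (rho/2)^r = 4 2^(2-r) rho^r. *)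
Lemma stage2_constant (r kap rho eps j : R) : 1 < r -> 0 <= kap -> 0 <= rho ->
  0 < eps -> 0 < j ->
  16 `^ (r - 1)^-1 * kap * eps `^ (- (1 + (r - 1)^-1)) *
    (rho / 2) `^ (1 + (r - 1)^-1) <= j ->
  j * (2 `^ (2 - r) * (kap `^ (r - 1) * rho `^ r)) <= 4^-1 * (j * eps) `^ r.
Proof.
move=> r1 kap0 rho0 eps0 j0 jge; have u0 : 0 < r - 1 by lra.
rewrite powR2_compl; set u := r - 1 in u0 jge *.
have rE : r = 1 + u by rewrite /u; ring.
have sE : (1 + u^-1) * u = r by rewrite /u; field; rewrite lt0r_neq0.
have A0 : 0 < 2 `^ u :> R by rewrite powR_gt0.
have i2 : (2^-1 : R) `^ r = (2 * 2 `^ u)^-1.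
  rewrite -powR_succ// -rE -[in RHS]powRN -[2^-1]powR_inv1// -powRrM.
  by rewrite mulN1r.
have ju : 16 * kap `^ u * (eps `^ r)^-1 * (rho `^ r / (2 * 2 `^ u)) <= j `^ u.
  have -> : 16 * kap `^ u * (eps `^ r)^-1 * (rho `^ r / (2 * 2 `^ u)) =
    (16 `^ u^-1 * kap * eps `^ (- (1 + u^-1)) * (rho / 2) `^ (1 + u^-1)) `^ u.
    rewrite !powRM ?mulr_ge0 ?powR_ge0 ?invr_ge0//.
    rewrite -!powRrM mulVf ?lt0r_neq0// powRr1// mulNr !sE powRN i2.
    by rewrite !mulrA.
  by apply: ge0_ler_powR; rewrite ?nnegrE ?(ltW u0) ?mulr_ge0 ?powR_ge0 ?(ltW j0).
rewrite powRM ?(ltW eps0) ?(ltW j0)// {2}rE powR_succ//.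
have E0 : 0 < eps `^ r by rewrite powR_gt0.
move: ju A0 E0; move: (2 `^ u) (kap `^ u) (rho `^ r) (eps `^ r) (j `^ u).
move=> A k p e n ju A0 E0.
have -> : j * (2 / A * (k * p)) = 4^-1 * (j * (16 * k / e * (p / (2 * A))) * e).
  by field; rewrite !gt_eqF.
by rewrite ler_wpM2l// ler_wpM2r ?(ltW E0)// ler_wpM2l// ltW.
Qed.

(** The bound on 2n+1 says (3/4)^(2n+1) <= delta^2. Squaring the claim makes this applicable and
    avoids the half-integer power. *)
Lemma majority_constant (delta : R) (n : nat) : 0 < delta -> delta < 1 / 2 ->
  2 * ln delta^-1 / ln (4 / 3) <= (n.*2.+1)%:R :> R ->
  4^-1 * (3 / 4) ^+ n <= delta / 2.
Proof.
move=> d0 d12 H.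
have l43 : 0 < ln (4 / 3 : R) by rewrite ln_gt0//; lra.
have key : (3 / 4) ^+ n.*2.+1 <= delta ^+ 2.
  have q0 : 0 < 4 / 3 :> R by lra.
  have -> : (3 / 4 : R) = (4 / 3)^-1 by field.
  rewrite -ler_ln ?posrE ?exprn_gt0 ?invr_gt0// !lnXn ?invr_gt0//.
  have dE : ln delta = - ln delta^-1 by rewrite lnV ?posrE// opprK.
  rewrite (lnV q0) dE !mulNrn lerN2 -[leRHS]mulr_natl -[leLHS]mulr_natl.
  by rewrite -ler_pdivrMr.
rewrite -(@ler_pXn2r _ 2)// ?nnegrE ?mulr_ge0 ?exprn_ge0 ?(ltW d0)//.
rewrite [leLHS]exprMn [leRHS]exprMn -exprM muln2.
rewrite exprS in key; move: key; move: ((3 / 4) ^+ n.*2) => x.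
by move=> key; have := sqr_ge0 delta; lra.
Qed.

End Constants.

(** * Statistics of a single block *)

Definition block (n0 m l : nat) : set nat :=
  [set i | (n0 + l * m <= i < n0 + l.+1 * m)%N].

Lemma block_disjoint n0 m i j : i != j -> block n0 m i `&` block n0 m j = set0.
Proof.
move=> ij; apply/seteqP; split=> // a [/= /andP[ia ai] /andP[ja aj]].
by case: (ltngtP i j) ij => // [lij|lji] _; nia.
Qed.

Section Blocks.
Context d (T : measurableType d) (R : realType) (P : probability T R).
Variables (Y : {RV P >-> R}) (Ys : nat -> {RV P >-> R}).
Hypothesis iidY : iid_copies P Y Ys.

Let indepY : mutually_independent P Ys := iidY.1.

Lemma ge0_integralD_scale (f g : T -> R) (c : R) : 0 <= c ->
  measurable_fun setT f -> measurable_fun setT g ->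
  (forall w, 0 <= f w) -> (forall w, 0 <= g w) ->
  (\int[P]_w ((f w)%:E + c%:E * (g w)%:E) =
   \int[P]_w (f w)%:E + c%:E * \int[P]_w (g w)%:E)%E.
Proof.
move=> c0 mf mg f0 g0.
have mEg : measurable_fun setT (EFin \o g) by exact/measurable_EFinP.
have mcEg : measurable_fun setT (fun w => c%:E * (g w)%:E)%E.
  by apply/measurable_EFinP; exact: measurable_funM.
have g0' w : setT w -> (0 <= (EFin \o g) w)%E by rewrite lee_fin.
have cg0' w : setT w -> (0 <= c%:E * (g w)%:E)%E.
  by rewrite -EFinM lee_fin mulr_ge0.
rewrite (ge0_integralD P measurableT _ _ cg0' mcEg).
- by rewrite (ge0_integralZl_EFin P measurableT g0' mEg c0).
- by move=> w _; rewrite lee_fin.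
- exact/measurable_EFinP.
Qed.

Lemma iid_ge0_integral (f : R -> \bar R) i :
  measurable_fun setT f -> (forall y, (0 <= f y)%E) ->
  (\int[P]_w f (Ys i w) = \int[P]_w f (Y w))%E.
Proof.
move=> mf f0.
transitivity (\int[distribution P (Ys i)]_y f y)%E.
  by rewrite ge0_integral_distribution.
transitivity (\int[distribution P Y]_y f y)%E; last by rewrite ge0_integral_distribution.
by apply: eq_measure_integral => B mB _; exact: iidY.2.
Qed.

Lemma iid_integrable i (h : R -> R) : measurable_fun setT h ->
  P.-integrable setT (fun w => (h (Y w))%:E) ->
  P.-integrable setT (fun w => (h (Ys i w))%:E).
Proof.
move=> mh /integrableP[_ hoo]; apply/integrableP; split.
  by apply/measurable_EFinP; exact: measurableT_comp.
have := @iid_ge0_integral (fun y => `|(h y)%:E|%E) i.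
move=> -> //; apply: measurableT_comp => //; exact/measurable_EFinP.
Qed.

Lemma iid_integral i (h : R -> R) : measurable_fun setT h ->
  P.-integrable setT (fun w => (h (Y w))%:E) ->
  (\int[P]_w (h (Ys i w))%:E = \int[P]_w (h (Y w))%:E)%E.
Proof.
move=> mh ih; have ihi := iid_integrable i mh ih.
have mEh : measurable_fun setT (EFin \o h) by exact/measurable_EFinP.
transitivity (\int[distribution P (Ys i)]_y (h y)%:E)%E.
  by rewrite integral_distribution.
transitivity (\int[distribution P Y]_y (h y)%:E)%E; last by rewrite integral_distribution.
by apply: eq_measure_integral => B mB _; exact: iidY.2.
Qed.

Lemma adapted_block_mean n0 m l :
  adapted Ys (block n0 m l) (fun w => block_mean n0 m (Ys^~ w) l).
Proof.
apply: measurable_funM; last exact: measurable_cst.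
by apply: adapted_sum => i il; exact: adapted_RV.
Qed.

Lemma adapted_block_moment m l :
  adapted Ys (block 0 m l) (fun w => block_moment 1 m (Ys^~ w) l).
Proof.
apply: measurable_funM; last exact: measurable_cst.
apply: adapted_sum => i il.
apply: (measurableT_comp (measurable_powR 1)).
apply: measurableT_comp => //; apply: measurable_funB; first exact: adapted_RV.
exact: adapted_block_mean.
Qed.

Lemma block_moment_ge0 m l (y : nat -> R) : 0 <= block_moment 1 m y l.
Proof. by rewrite divr_ge0// sumr_ge0// => i _; exact: powR_ge0. Qed.

Lemma block_moment1E m l (y : nat -> R) : block_moment 1 m y l =
  (\sum_(l * m <= i < l.+1 * m) `|y i - block_mean 0 m y l|) / m%:R.
Proof. by congr (_ / _); apply: eq_bigr => i _; rewrite powRr1. Qed.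

Lemma sum_block_const m l (c : R) :
  \sum_(l * m <= i < l.+1 * m) c = m%:R * c.
Proof. by rewrite big_const_nat iter_addr addr0 mulSn addnK mulr_natl. Qed.

Lemma block_mean_sub n0 m l (y : nat -> R) (c : R) : (0 < m)%N ->
  block_mean n0 m y l - c =
  (\sum_(n0 + l * m <= i < n0 + l.+1 * m) (y i - c)) / m%:R.
Proof.
move=> m0; rewrite sumrB big_const_nat iter_addr addr0.
have -> : (n0 + l.+1 * m - (n0 + l * m) = m)%N by lia.
rewrite mulrBl -/(block_mean n0 m y l).
by rewrite -[c *+ m]mulr_natr mulfK ?pnatr_eq0 -?lt0n.
Qed.

Lemma norm_block_mean_sub_le m l (y : nat -> R) (c : R) : (0 < m)%N ->
  `|block_mean 0 m y l - c| <= (\sum_(l * m <= i < l.+1 * m) `|y i - c|) / m%:R.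
Proof.
move=> m0; rewrite block_mean_sub// !add0n normrM [X in _ * X]ger0_norm ?invr_ge0//.
by rewrite ler_wpM2r ?invr_ge0// ler_norm_sum.
Qed.

(** The block mean differs from c by at most the average of |y i - c|, so centering at it instead of
    c at most doubles that average. *)
Lemma block_moment1_le m l (y : nat -> R) (c : R) : (0 < m)%N ->
  block_moment 1 m y l <=
  2 * ((\sum_(l * m <= i < l.+1 * m) `|y i - c|) / m%:R).
Proof.
move=> m0; rewrite block_moment1E.
have m0' : 0 < m%:R :> R by rewrite ltr0n.
have := norm_block_mean_sub_le l y c m0; set b := `|_ - c| => bE.
apply: (@le_trans _ _ ((\sum_(l * m <= i < l.+1 * m) (`|y i - c| + b)) / m%:R)).
  rewrite ler_wpM2r ?invr_ge0//; apply: ler_sum => i _.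
  have -> : y i - block_mean 0 m y l = (y i - c) - (block_mean 0 m y l - c) by ring.
  exact: ler_normB.
rewrite big_split/= sum_block_const mulrDl mulrAC mulfV ?mul1r ?lt0r_neq0//; lra.
Qed.

(** A deterministic estimate: the shortfall below rho splits into the error of the block mean and
    the fluctuation of |y i - c| around rho. For c = E Y and rho = E|Y - c| both are sums of
    independent centered variables. *)
Lemma block_moment1_ge m l (y : nat -> R) (c rho : R) : (0 < m)%N ->
  rho - block_moment 1 m y l <=
  (`|\sum_(l * m <= i < l.+1 * m) (y i - c)| +
   `|\sum_(l * m <= i < l.+1 * m) (`|y i - c| - rho)|) / m%:R.
Proof.
move=> m0; rewrite block_moment1E.
have m0' : 0 < m%:R :> R by rewrite ltr0n.
have bE : m%:R * `|block_mean 0 m y l - c| = `|\sum_(l * m <= i < l.+1 * m) (y i - c)|.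
  rewrite block_mean_sub// !add0n normrM [X in _ * (_ * X)]ger0_norm ?invr_ge0// mulrCA mulfV ?mulr1//.
  by rewrite lt0r_neq0.
rewrite ler_pdivlMr// -bE mulrBl divfK ?lt0r_neq0// lerBlDr.
set b := `|_ - c| in bE *.
have : m%:R * rho <= \sum_(l * m <= i < l.+1 * m) `|y i - c| +
    `|\sum_(l * m <= i < l.+1 * m) (`|y i - c| - rho)|.
  rewrite sumrB sum_block_const.
  move: (\sum_(_ <= _ < _) _) => S; have := ler_norm (m%:R * rho - S).
  by rewrite distrC; lra.
have : \sum_(l * m <= i < l.+1 * m) `|y i - c| <=
    m%:R * b + \sum_(l * m <= i < l.+1 * m) `|y i - block_mean 0 m y l|.
  rewrite -(sum_block_const m l) -big_split/=; apply: ler_sum => i _.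
  have -> : y i - c = (block_mean 0 m y l - c) + (y i - block_mean 0 m y l) by ring.
  exact: ler_normD.
by rewrite [rho * _]mulrC; lra.
Qed.

Variables (r kap rho : R).
Hypotheses (r12 : 1 < r <= 2) (kap_ge0 : 0 <= kap).
Let mu := mean P Y.
Hypothesis Yint : P.-integrable setT (EFin \o Y).
Hypothesis abs1 : (\int[P]_w (`|Y w - mean P Y|)%:E = rho%:E)%E.
Hypothesis mean0 : (\int[P]_w (Y w - mean P Y)%:E = 0)%E.
Hypothesis momr :
  (\int[P]_w (`|Y w - mean P Y| `^ r)%:E <= (kap `^ (r - 1) * rho `^ r)%:E)%E.

Let rho_ge0 : 0 <= rho.
Proof. by rewrite -lee_fin -abs1; apply: integral_ge0 => w _; rewrite lee_fin. Qed.

Let mh1 : measurable_fun setT (fun y : R => y - mu).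
Proof. exact: measurable_funB. Qed.

Let mh1' : measurable_fun setT (fun y : R => `|y - mu|).
Proof. exact: measurableT_comp. Qed.

Let mh2 : measurable_fun setT (fun y : R => `|y - mu| - rho).
Proof. exact: measurable_funB. Qed.

Let ih1 : P.-integrable setT (fun w => (Y w - mu)%:E).
Proof.
exact: (integrableB measurableT Yint (finite_measure_integrable_cst P mu measurableT)).
Qed.

Let ih1' : P.-integrable setT (fun w => (`|Y w - mu|)%:E).
Proof. exact: (integrable_abse ih1). Qed.

Let ih2 : P.-integrable setT (fun w => (`|Y w - mu| - rho)%:E).
Proof.
exact: (integrableB measurableT ih1' (finite_measure_integrable_cst P rho measurableT)).
Qed.

Let mean0' : (\int[P]_w (`|Y w - mu| - rho)%:E = 0)%E.
Proof.
under eq_integral do rewrite EFinB.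
rewrite (integralB measurableT ih1' (finite_measure_integrable_cst P rho measurableT)).
by rewrite integral_cst_prob abs1 subee.
Qed.

(** Integrate [powR_norm_add] with a = -rho and b = |X|: the terms rho^r - r rho^r that remain are
    nonpositive. The linear term is first moved to the left, so that all integrands are
    nonnegative. *)
Let momr' : (\int[P]_w (`| `|Y w - mu| - rho| `^ r)%:E <=
  (2 `^ (2 - r) * (kap `^ (r - 1) * rho `^ r))%:E)%E.
Proof.
have /andP[r1 r2] := r12.
have r0 : 0 < r by lra.
have rr0 : 0 <= r * rho `^ (r - 1) by rewrite mulr_ge0 ?powR_ge0// ltW.
have rhor : rho * rho `^ (r - 1) = rho `^ r by rewrite mulr_powRB1.
have mD : measurable_fun setT (fun w => `|Y w - mu|) by exact: measurableT_comp mh1' _.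
have mDr : measurable_fun setT (fun w => `|Y w - mu| `^ r).
  exact: (measurableT_comp (measurable_powR r) mD).
have mZ : measurable_fun setT (fun w => `| `|Y w - mu| - rho| `^ r).
  by apply: measurable_normpowR; exact: measurable_funB.
have := @ge0_le_integral _ T R P setT measurableT
  (fun w => (`| `|Y w - mu| - rho| `^ r)%:E + (r * rho `^ (r - 1))%:E * (`|Y w - mu|)%:E)%E
  (fun w => (rho `^ r)%:E + (2 `^ (2 - r))%:E * (`|Y w - mu| `^ r)%:E)%E.
have pw w : `| `|Y w - mu| - rho| `^ r + r * rho `^ (r - 1) * `|Y w - mu| <=
  rho `^ r + 2 `^ (2 - r) * `|Y w - mu| `^ r.
  have := powR_norm_add (- rho) `|Y w - mu| r12.
  rewrite normrN (ger0_norm rho_ge0) normr_id (addrC (- rho)).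
  have -> : Num.sg (- rho) * rho `^ (r - 1) = - rho `^ (r - 1).
    have [->|rn0] := eqVneq rho 0.
      by rewrite powR0 ?mulr0 ?oppr0//; apply/eqP; lra.
    by rewrite sgrN gtr0_sg ?mulN1r// lt_neqAle eq_sym rn0.
  lra.
rewrite !ge0_integralD_scale ?powR_ge0//; try (by move=> w; exact: powR_ge0).
rewrite integral_cst_prob abs1 => H.
have {}H := H _ _ _ _.
have : (\int[P]_w (`| `|Y w - mu| - rho| `^ r)%:E + (r * rho `^ r)%:E <=
  (rho `^ r)%:E + (2 `^ (2 - r) * (kap `^ (r - 1) * rho `^ r))%:E)%E.
  rewrite [X in (_ <= _ + X)%E]EFinM.
  apply: (@le_trans _ _ ((rho `^ r)%:E +
      (2 `^ (2 - r))%:E * \int[P]_w (`|Y w - mu| `^ r)%:E)%E); last first.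
    by rewrite leeD2l// lee_pmul2l ?lte_fin ?powR_gt0.
  have -> : (r * rho `^ r)%:E = ((r * rho `^ (r - 1))%:E * rho%:E)%E.
    by rewrite -EFinM -mulrA [_ * rho]mulrC rhor.
  apply: H.
  - by move=> w _; rewrite -EFinM -EFinD lee_fin addr_ge0 ?powR_ge0 ?mulr_ge0 ?powR_ge0 ?(ltW r0).
  - apply: emeasurable_funD; apply/measurable_EFinP => //; exact: measurable_funM.
  - apply: emeasurable_funD; apply/measurable_EFinP => //; exact: measurable_funM.
  - by move=> w _; rewrite -!EFinM -!EFinD lee_fin.
have J0 : (0 <= \int[P]_w (`| `|Y w - mu| - rho| `^ r)%:E)%E.
  by apply: integral_ge0 => w _; rewrite lee_fin powR_ge0.
move: J0; case: (\int[P]_w _)%E => [x|//|//].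
rewrite -!EFinD !lee_fin => _ H'.
have : rho `^ r <= r * rho `^ r by rewrite ler_peMl ?powR_ge0// ltW.
lra.
Qed.

Let sum_measurable (h : R -> R) a b : measurable_fun setT h ->
  measurable_fun setT (fun w => \sum_(a <= i < b) h (Ys i w)).
Proof.
move=> mh; apply: (@adapted_measurable _ _ _ P Ys setT).
by apply: adapted_sum => i _; exact: adapted_comp.
Qed.

Let sum_moment a n :
  (\int[P]_w (`|\sum_(a <= i < a + n) (Ys i w - mu)| `^ r)%:E <=
   (n%:R * (2 `^ (2 - r) * (kap `^ (r - 1) * rho `^ r)))%:E)%E.
Proof.
have H1 i : P.-integrable setT (fun w => (Ys i w - mu)%:E).
  exact: (iid_integrable i mh1).
have H2 i : (\int[P]_w (Ys i w - mu)%:E = 0)%E by rewrite (iid_integral i mh1).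
have H3 i : (\int[P]_w (`|Ys i w - mu| `^ r)%:E <=
    (kap `^ (r - 1) * rho `^ r)%:E)%E.
  have mf : measurable_fun setT (fun y : R => (`|y - mu| `^ r)%:E).
    by apply/measurable_EFinP; exact: measurable_normpowR.
  have f0 (y : R) : (0 <= (`|y - mu| `^ r)%:E)%E by rewrite lee_fin powR_ge0.
  by rewrite (iid_ge0_integral i mf f0).
exact: (bahr_esseen indepY r12 mh1 H1 H2 H3 a n).
Qed.

Let abs_sum_moment a n :
  (\int[P]_w (`|\sum_(a <= i < a + n) (`|Ys i w - mu| - rho)| `^ r)%:E <=
   (n%:R * (2 `^ (2 - r) * (2 `^ (2 - r) * (kap `^ (r - 1) * rho `^ r))))%:E)%E.
Proof.
have H1 i : P.-integrable setT (fun w => (`|Ys i w - mu| - rho)%:E).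
  exact: (iid_integrable i mh2).
have H2 i : (\int[P]_w (`|Ys i w - mu| - rho)%:E = 0)%E.
  by rewrite (iid_integral i mh2).
have H3 i : (\int[P]_w (`| `|Ys i w - mu| - rho| `^ r)%:E <=
    (2 `^ (2 - r) * (kap `^ (r - 1) * rho `^ r))%:E)%E.
  have mf : measurable_fun setT (fun y : R => (`| `|y - mu| - rho| `^ r)%:E).
    by apply/measurable_EFinP; exact: measurable_normpowR.
  have f0 (y : R) : (0 <= (`| `|y - mu| - rho| `^ r)%:E)%E.
    by rewrite lee_fin powR_ge0.
  by rewrite (iid_ge0_integral i mf f0).
exact: (bahr_esseen indepY r12 mh2 H1 H2 H3 a n).
Qed.

(** If the statistic falls below rho/2, then |S1| + |S2| is at least m rho/2; convexity passes this
    on to the sum of the r-th powers, to which Markov's inequality applies once. *)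
Lemma stage1_block m l : (0 < m)%N -> 3 * 48 `^ (r - 1)^-1 * kap <= m%:R ->
  (P [set w | (block_moment 1 m (Ys^~ w) l < rho / 2)%R] <= (4^-1)%:E)%E.
Proof.
move=> m0 mkap; have /andP[r1 r2] := r12.
have r0 : 0 < r by apply: lt_trans r1.
have m0' : 0 < m%:R :> R by rewrite ltr0n.
have mR : measurable [set w | (block_moment 1 m (Ys^~ w) l < rho / 2)%R].
  rewrite -[X in measurable X]setTI; apply: measurable_fun_ltr => //.
  exact: adapted_measurable (@adapted_block_moment m l).
(* Markov's inequality needs a positive threshold; for rho = 0 the event is empty, as the statistic
   is nonnegative. *)
have [rho0|rhon0] := eqVneq rho 0.
  rewrite (_ : [set w | _] = set0) ?measure0 ?lee_fin//.
  apply/seteqP; split=> // w /=; rewrite rho0 mul0r ltNge.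
  by rewrite block_moment_ge0.
have rhop : 0 < rho by rewrite lt_neqAle eq_sym rhon0.
pose S1 w := \sum_(l * m <= i < l.+1 * m) (Ys i w - mu).
pose S2 w := \sum_(l * m <= i < l.+1 * m) (`|Ys i w - mu| - rho).
pose g w := `|S1 w| `^ r + `|S2 w| `^ r.
have mS1 : measurable_fun setT (fun w => `|S1 w| `^ r).
  by apply: measurable_normpowR; exact: sum_measurable mh1.
have mS2 : measurable_fun setT (fun w => `|S2 w| `^ r).
  by apply: measurable_normpowR; exact: sum_measurable mh2.
have mg : measurable_fun setT g by exact: measurable_funD.
have g0 w : 0 <= g w by rewrite addr_ge0 ?powR_ge0.
have A0 : 0 < 2 `^ (r - 1) :> R by rewrite powR_gt0.
have c0 : 0 < (m%:R * (rho / 2)) `^ r by rewrite powR_gt0 ?mulr_gt0 ?divr_gt0.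
have blockE : (l.+1 * m = l * m + m)%N by rewrite mulSnr.
have gM := leeD (sum_moment (l * m) m) (abs_sum_moment (l * m) m).
have {}gM : (\int[P]_w (g w)%:E <= (m%:R * (2 `^ (2 - r) * (kap `^ (r - 1) * rho `^ r)) +
    m%:R * (2 `^ (2 - r) * (2 `^ (2 - r) * (kap `^ (r - 1) * rho `^ r))))%:E)%E.
  rewrite EFinD; apply: le_trans gM; rewrite -blockE.
  rewrite /g; under eq_integral do rewrite EFinD.
  rewrite ge0_integralD//.
  - exact/measurable_EFinP.
  - exact/measurable_EFinP.
have cA : 0 < (m%:R * (rho / 2)) `^ r / 2 `^ (r - 1) by rewrite divr_gt0.
apply: (@le_trans _ _ (P [set w | ((m%:R * (rho / 2)) `^ r / 2 `^ (r - 1) <= g w)%R])).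
  apply: le_measure; rewrite ?inE//.
    rewrite -[X in measurable X]setTI; exact: measurable_fun_ler.
  move=> w /= Rw; rewrite ler_pdivrMr// [leRHS]mulrC /g.
  apply: le_trans (powR_add_le (ltW r1) (normr_ge0 (S1 w)) (normr_ge0 (S2 w))).
  apply: ge0_ler_powR; rewrite ?nnegrE ?addr_ge0 ?mulr_ge0 ?(ltW r0) ?(ltW m0') ?divr_ge0//.
  have := @block_moment1_ge m l (Ys^~ w) mu rho m0.
  rewrite -/(S1 w) -/(S2 w) ler_pdivlMr//; apply: le_trans.
  by rewrite mulrC ler_pM2r//; lra.
apply: (le_trans (prob_ge_le cA mg g0 gM)).
rewrite lee_fin ler_pdivrMr// [leRHS]mulrA ler_pdivlMr// [leLHS]mulrC.
exact: stage1_constant.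
Qed.

(** The block length j is deterministic here; the lower bound on it is the unrounded stage-2 size
    for a stage-1 median of exactly rho/2. *)
Lemma stage2_block eps n0 j l : 0 < eps -> (0 < j)%N ->
  16 `^ (r - 1)^-1 * kap * eps `^ (- (1 + (r - 1)^-1)) *
    (rho / 2) `^ (1 + (r - 1)^-1) <= j%:R ->
  (P [set w | (eps < `|block_mean n0 j (Ys^~ w) l - mean P Y|)%R] <= (4^-1)%:E)%E.
Proof.
move=> eps0 j0 jge; have /andP[r1 r2] := r12.
have r0 : 0 < r by apply: lt_trans r1.
have j0' : 0 < j%:R :> R by rewrite ltr0n.
pose S1 w := \sum_(n0 + l * j <= i < n0 + l.+1 * j) (Ys i w - mu).
have mS1 : measurable_fun setT (fun w => `|S1 w| `^ r).
  by apply: measurable_normpowR; exact: sum_measurable mh1.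
have g0 w : 0 <= `|S1 w| `^ r by exact: powR_ge0.
have c0 : 0 < (j%:R * eps) `^ r by rewrite powR_gt0 ?mulr_gt0.
have gM : (\int[P]_w (`|S1 w| `^ r)%:E <=
    (j%:R * (2 `^ (2 - r) * (kap `^ (r - 1) * rho `^ r)))%:E)%E.
  rewrite /S1 mulSnr addnA.
  exact: sum_moment.
apply: (@le_trans _ _ (P [set w | ((j%:R * eps) `^ r <= `|S1 w| `^ r)%R])).
  apply: le_measure; rewrite ?inE.
  - rewrite -[X in measurable X]setTI; apply: measurable_fun_ltr => //.
    apply: measurableT_comp => //; apply: measurable_funB => //.
    exact: adapted_measurable (@adapted_block_mean n0 j l).
  - rewrite -[X in measurable X]setTI; exact: measurable_fun_ler.
  move=> w /=; rewrite (block_mean_sub n0 l _ _ j0) -/(S1 w) normrM.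
  rewrite [X in _ * X]ger0_norm ?invr_ge0// ltr_pdivlMr// => /ltW H.
  apply: ge0_ler_powR; rewrite ?nnegrE ?mulr_ge0 ?(ltW r0) ?(ltW j0') ?(ltW eps0)//.
  by rewrite mulrC.
apply: (le_trans (prob_ge_le c0 mS1 g0 gM)).
rewrite lee_fin ler_pdivrMr//.
exact: stage2_constant.
Qed.

Lemma block_moment_mean m l : (0 < m)%N ->
  (\int[P]_w (block_moment 1 m (Ys^~ w) l)%:E <= (2 * rho)%:E)%E.
Proof.
move=> m0; have m0' : 0 < m%:R :> R by rewrite ltr0n.
have mB := adapted_measurable (@adapted_block_moment m l).
have mF i : measurable_fun setT (fun w => (`|Ys i w - mu|)%:E).
  by apply/measurable_EFinP; exact: (measurableT_comp mh1').
have mS : measurable_fun setT (fun w => \sum_(l * m <= i < l.+1 * m) `|Ys i w - mu|).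
  exact: sum_measurable mh1'.
have f0 (y : R) : (0 <= (`|y - mu|)%:E)%E by rewrite lee_fin.
have mf : measurable_fun setT (fun y : R => (`|y - mu|)%:E) by exact/measurable_EFinP.
have sumE : (\int[P]_w (\sum_(l * m <= i < l.+1 * m) `|Ys i w - mu|)%:E =
    (m%:R * rho)%:E)%E.
  under eq_integral do rewrite -sumEFin.
  rewrite ge0_integral_sum//.
  under eq_bigr => i _ do rewrite (iid_ge0_integral i mf f0) abs1.
  by rewrite sumEFin sum_block_const.
have c0 : 0 <= 2 / m%:R :> R by rewrite divr_ge0.
have -> : (2 * rho)%:E = ((2 / m%:R)%:E *
    \int[P]_w (\sum_(l * m <= i < l.+1 * m) `|Ys i w - mu|)%:E)%E.
  by rewrite sumE -EFinM; congr EFin; field; rewrite gt_eqF.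
have sum0 w : setT w -> (0 <= (\sum_(l * m <= i < l.+1 * m) `|Ys i w - mu|)%:E)%E.
  by move=> _; rewrite lee_fin sumr_ge0.
have mSE : measurable_fun setT (fun w => (\sum_(l * m <= i < l.+1 * m) `|Ys i w - mu|)%:E).
  exact/measurable_EFinP.
rewrite -(ge0_integralZl_EFin P measurableT sum0 mSE c0).
apply: ge0_le_integral => //.
- by move=> w _; rewrite lee_fin block_moment_ge0.
- exact/measurable_EFinP.
- by apply/measurable_EFinP; exact: measurable_funM.
- move=> w _; rewrite -EFinM lee_fin.
  apply: (le_trans (block_moment1_le l (Ys^~ w) mu m0)).
  by rewrite mulrA mulrAC.
Qed.

End Blocks.

(** * Random indices, medians and rounding *)

Section RandomIndex.
Context d (T : measurableType d) (R : realType) (P : probability T R).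

(** Total probability over the value of a random index: [S j] says that the index is j, and [H j]
    that index j fails. *)
Lemma prob_random_index (S H : nat -> set T) (c : R) : 0 <= c ->
  (forall j, measurable (S j)) -> (forall j, measurable (H j)) ->
  trivIset setT S -> (forall j, (P (S j `&` H j) <= c%:E * P (S j))%E) ->
  (P (\bigcup_j (S j `&` H j)) <= c%:E)%E.
Proof.
move=> c0 mS mH tS SH.
have tSH : trivIset setT (fun j => S j `&` H j).
  apply/trivIsetP => i j _ _ ij; rewrite setIACA.
  by move/trivIsetP : tS => /(_ i j I I ij) ->; rewrite set0I.
rewrite measure_bigcup//; last by move=> j _; exact: measurableI.
apply: (@le_trans _ _ (\sum_(0 <= j <oo | j \in [set: nat]) (c%:E * P (S j)))%E).
  apply: lee_nneseries => [j _ _|j _]; [exact: measure_ge0|exact: SH].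
rewrite nneseriesZl// -measure_bigcup//.
rewrite -[leRHS]mule1 lee_wpmul2l ?lee_fin//.
by apply: probability_le1; exact: bigcup_measurable.
Qed.

End RandomIndex.

Section Medians.
Context d (T : measurableType d) (R : realType) (P : probability T R).
Variable X : nat -> {RV P >-> R}.
Variables (A : nat -> set nat) (F : nat -> T -> R).
Hypothesis FA : forall l, adapted X (A l) (F l).

(** Open half-lines generate the Borel sets, and the median exceeds t exactly if a majority of the
    entries does. *)
Lemma adapted_median k : odd k ->
  adapted X (\bigcup_(l in `I_k) A l) (fun w => median [seq F l w | l <- iota 0 k]).
Proof.
move=> ok; apply: (measurability _ (RGenOInfty.measurableE R)) => // _ [_ [t ->] <-].
rewrite setTI.
rewrite (_ : _ @^-1` _ = [set w | (k./2.+1 <= count (fun l => (t < F l w)%R) (iota 0 k))%N]).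
  apply: (@events_majority _ _ _ _ X A (fun l w => t < F l w)) => l.
  rewrite (_ : [set w | _] = F l @^-1` `]t, +oo[%classic).
    by apply: (adapted_preimage (@FA l)); exact: measurable_itv.
  by apply/seteqP; split=> w /=; rewrite in_itv/= andbT.
apply/seteqP; split=> w; rewrite /= in_itv/= andbT;
  rewrite (@median_map_majority _ (fun x => t < x) (F^~ w) k)//;
  by left => x y xy tx; exact: lt_le_trans xy.
Qed.

(** The entries beyond a far median form a majority on one side of c. *)
Lemma median_far c eps k w : odd k ->
  eps < `|median [seq F l w | l <- iota 0 k] - c| ->
  (k./2 < count (fun l => (eps < `|F l w - c|)%R) (iota 0 k))%N.
Proof.
move=> ok; set M := median _.
have [cM|Mc] := leP c M.
  rewrite ger0_norm ?subr_ge0// ltrBrDr => H.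
  have : c + eps < M by rewrite addrC.
  rewrite (@median_map_majority _ (fun x => c + eps < x) (F^~ w) k)//; last first.
    by left => x y xy tx; exact: lt_le_trans xy.
  move=> /leq_trans; apply; apply: sub_count => l /= cF.
  by apply: lt_le_trans (ler_norm _); lra.
rewrite ltr0_norm ?subr_lt0// opprB => H.
have : M < c - eps by lra.
rewrite (@median_map_majority _ (fun x => x < c - eps) (F^~ w) k)//; last first.
  by right => x y xy tx; exact: le_lt_trans tx.
move=> /leq_trans; apply; apply: sub_count => l /= cF.
by rewrite distrC; apply: lt_le_trans (ler_norm _); lra.
Qed.

End Medians.

Section StageSize.
Variable R : realType.

(** [second_stage_size] as a function of the stage-1 median alone, and convertible to it there. *)
Definition sample_size (s eta x : R) : nat := maxn (ceil_nat (eta * x `^ s)) 1.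

Lemma ceil_natE (x : R) : 0 <= x -> (ceil_nat x)%:R = (Num.ceil x)%:~R :> R.
Proof.
move=> x0; rewrite /ceil_nat natr_absz ger0_norm// ceil_ge0.
by apply: lt_le_trans x0; rewrite ltrN10.
Qed.

Lemma ceil_nat_ge (x : R) : 0 <= x -> x <= (ceil_nat x)%:R.
Proof. by move=> x0; rewrite ceil_natE// ceil_ge. Qed.

Lemma ceil_nat_lt (x : R) : 0 <= x -> (ceil_nat x)%:R < x + 1.
Proof.
by move=> x0; rewrite ceil_natE// -ltrBlDr; have := ceilB1_lt x; rewrite intrB.
Qed.

Lemma sample_size_ge (s eta x : R) : 0 <= eta -> eta * x `^ s <= (sample_size s eta x)%:R.
Proof.
move=> eta0; apply: le_trans (ceil_nat_ge _) _; first by rewrite mulr_ge0 ?powR_ge0.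
by rewrite ler_nat leq_maxl.
Qed.

Lemma sample_size_le (s eta x : R) : 0 <= eta ->
  (sample_size s eta x)%:R <= 1 + eta * x `^ s.
Proof.
move=> eta0; have e0 : 0 <= eta * x `^ s by rewrite mulr_ge0 ?powR_ge0.
rewrite /sample_size; case: (leqP (ceil_nat (eta * x `^ s)) 1) => _; first by lra.
by have := ceil_nat_lt e0; lra.
Qed.

Lemma sample_size_gt0 (s eta x : R) : (0 < sample_size s eta x)%N.
Proof. by rewrite leq_maxr. Qed.

Lemma measurable_sample_size (s eta : R) : 0 <= eta ->
  measurable_fun setT (fun x : R => (sample_size s eta x)%:R : R).
Proof.
move=> eta0.
(* [ceil_nat] takes an absolute value and is monotone only on nonnegative arguments; truncation at 0
   makes [g] nondecreasing everywhere. *)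
pose g (z : R) : R := (maxn (ceil_nat (Num.max z 0)) 1)%:R.
have -> : (fun x : R => (sample_size s eta x)%:R) = g \o (fun x => eta * x `^ s).
  apply/funext => x; rewrite /= /g max_l// mulr_ge0 ?powR_ge0//.
apply: measurableT_comp; last first.
  by apply: measurable_funM => //; exact: measurable_powR.
apply: nondecreasing_measurable => // x y xy.
have cxy : (ceil_nat (Num.max x 0%R) <= ceil_nat (Num.max y 0%R))%N.
  rewrite -(ler_nat R) !ceil_natE ?le_max ?lexx ?orbT// ler_int.
  by apply: le_ceil; rewrite ge_max !le_max xy lexx orbT.
by rewrite /g ler_nat geq_max leq_max cxy leq_maxr.
Qed.

End StageSize.

Lemma odd_halfE k : odd k -> k = k./2.*2.+1.
Proof. by move=> ok; rewrite -[LHS]odd_double_half ok. Qed.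

Lemma half_odd_lt k : odd k -> (k./2 < k)%N.
Proof. by move=> ok; lia. Qed.

Lemma leq_double_halfS k : (k <= 2 * k./2.+1)%N.
Proof. lia. Qed.

Lemma bin_le_expn2 n j : ('C(n, j) <= 2 ^ n)%N.
Proof.
elim: n j => [|n IHn] [|j]; rewrite ?bin0 ?expn_gt0// binS.
by rewrite expnS mul2n -addnn leq_add.
Qed.

Lemma bigcup_block_sub n0 m k :
  \bigcup_(l in `I_k) block n0 m l `<=` [set i | (n0 <= i < n0 + k * m)%N].
Proof.
move=> i [l /= lk]; rewrite /block /= => /andP[li il]; apply/andP; split.
  exact: leq_trans (leq_addr _ _) li.
by apply: leq_trans il _; rewrite leq_add2l leq_mul2r lk orbT.
Qed.

(** * Accuracy and expected cost of the algorithm *)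

Section AdaptiveAlgorithm.
Context d (T : measurableType d) (R : realType) (P : probability T R).
Variables (Y : {RV P >-> R}) (Ys : nat -> {RV P >-> R}).
Hypothesis iidY : iid_copies P Y Ys.
Variables (r kap rho eps delta : R) (m k k' : nat).
Hypotheses (r12 : 1 < r <= 2) (kap_ge0 : 0 <= kap).
Hypothesis Yint : P.-integrable setT (EFin \o Y).
Hypothesis abs1 : (\int[P]_w (`|Y w - mean P Y|)%:E = rho%:E)%E.
Hypothesis mean0 : (\int[P]_w (Y w - mean P Y)%:E = 0)%E.
Hypothesis momr :
  (\int[P]_w (`|Y w - mean P Y| `^ r)%:E <= (kap `^ (r - 1) * rho `^ r)%:E)%E.
Hypotheses (m_gt0 : (0 < m)%N) (m_ge : 3 * 48 `^ (r - 1)^-1 * kap <= m%:R).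
Hypotheses (eps_gt0 : 0 < eps) (odd_k : odd k) (odd_k' : odd k').

Let s := 1 + (r - 1)^-1.
Let eta := 16 `^ (r - 1)^-1 * kap * eps `^ (- s).
Let A := adaptive_algorithm k 1 m k' s eta.
Let med w := median_of_moments k 1 m (Ys^~ w).
Let ssize w := sample_size s eta (med w).

Let indepY : mutually_independent P Ys := iidY.1.

Let rho_ge0 : 0 <= rho.
Proof. by rewrite -lee_fin -abs1; apply: integral_ge0 => w _; rewrite lee_fin. Qed.

Let eta_ge0 : 0 <= eta.
Proof. by rewrite !mulr_ge0 ?powR_ge0. Qed.

Let s_ge0 : 0 <= s.
Proof.
by have /andP[r1 _] := r12; rewrite addr_ge0// invr_ge0 subr_ge0 ltW.
Qed.

Let adapted_med : adapted Ys [set i | (i < k * m)%N] med.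
Proof.
have sub : \bigcup_(l in `I_k) block 0 m l `<=` [set i | (i < k * m)%N].
  by move=> i /bigcup_block_sub; case/andP.
apply: (adapted_sub sub).
exact: (adapted_median (fun l => @adapted_block_moment _ _ _ P Ys m l)).
Qed.

Let median_prob (B : nat -> set nat) (b : nat -> T -> bool) n :
  odd n -> 0 < delta -> delta < 1 / 2 ->
  2 * ln delta^-1 / ln (4 / 3) <= n%:R ->
  (forall i j, i != j -> B i `&` B j = set0) ->
  (forall l, events Ys (B l) [set w | b l w]) ->
  (forall l, (P [set w | b l w] <= (4^-1)%:E)%E) ->
  (P [set w | (n./2 < count (fun l => b l w) (iota 0 n))%N] <= (delta / 2)%:E)%E.
Proof.
move=> on d0 d12 nd dB bB bP.
rewrite [X in iota 0 X](odd_halfE on).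
apply: (le_trans (prob_majority indepY dB bB bP n./2)).
by rewrite lee_fin majority_constant// -odd_halfE.
Qed.

(** The size j is a free parameter, not the random [ssize], so that the event depends only on copies
    with index at least k m. *)
Let far (j : nat) (l : nat) (w : T) : bool :=
  eps < `|block_mean (k * m) j (Ys^~ w) l - mean P Y|.

Let far_events j l : events Ys (block (k * m) j l) [set w | far j l w].
Proof.
rewrite -[X in events _ _ X]setTI.
apply: (@measurable_fun_ltr _ (g_sigma_algebraType (cylinders Ys (block (k * m) j l)))) => //.
apply: measurableT_comp => //; apply: measurable_funB => //.
exact: adapted_block_mean.
Qed.

Let toofar j := [set w | (k'./2 < count (fun l => far j l w) (iota 0 k'))%N].

Let toofar_events j : events Ys [set i | (k * m <= i)%N] (toofar j).
Proof.
have sub : \bigcup_(l in `I_k') block (k * m) j l `<=` [set i | (k * m <= i)%N].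
  by move=> i /bigcup_block_sub; case/andP.
apply: (sub_events sub).
exact: (@events_majority _ _ _ _ Ys _ (far j) (@far_events j)).
Qed.

Let ssize_measurable :
  measurable_fun [set: g_sigma_algebraType (cylinders Ys [set i | (i < k * m)%N])]
    (fun w => (ssize w)%:R : R).
Proof. exact: (measurableT_comp (measurable_sample_size s eta_ge0) adapted_med). Qed.

Let ssize_events j :
  events Ys [set i | (i < k * m)%N] [set w | ssize w = j].
Proof.
have := ssize_measurable measurableT (measurable_set1 (j%:R : R)).
rewrite setTI (_ : _ @^-1` _ = [set w | ssize w = j])//.
apply/seteqP; split=> w /= => [/eqP|->//].
by rewrite eqr_nat => /eqP.
Qed.

Let output_measurable :
  measurable [set w | (`|output A (Ys^~ w) - mean P Y| <= eps)%R].
Proof.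
pose mom j w := median_of_means (k * m) k' j (Ys^~ w).
rewrite (_ : [set w | _] = \bigcup_j ([set w | ssize w = j] `&`
    [set w | `|mom j w - mean P Y| <= eps])).
  apply: bigcup_measurable => j _; apply: measurableI.
    exact: (events_measurable (@ssize_events j)).
  rewrite -[X in measurable X]setTI; apply: measurable_fun_ler => //.
  apply: measurableT_comp => //; apply: measurable_funB => //.
  apply: (@adapted_measurable _ _ _ P Ys (\bigcup_(l in `I_k') block (k * m) j l)).
  exact: (adapted_median (fun l => @adapted_block_mean _ _ _ P Ys (k * m) j l)).
by apply/seteqP; split=> w /= => [H|[j _ [/= <-]]//]; exists (ssize w).
Qed.

Section Accuracy.
Hypotheses (delta_gt0 : 0 < delta) (delta_lt : delta < 1 / 2).
Hypotheses (k_ge : 2 * ln delta^-1 / ln (4 / 3) <= k%:R)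
  (k'_ge : 2 * ln delta^-1 / ln (4 / 3) <= k'%:R).

Let low := [set w | med w < rho / 2].

Let low_measurable : measurable low.
Proof.
rewrite -[X in measurable X]setTI; apply: measurable_fun_ltr => //.
exact: adapted_measurable adapted_med.
Qed.

Let low_prob : (P low <= (delta / 2)%:E)%E.
Proof.
pose b l w := block_moment 1 m (Ys^~ w) l < rho / 2.
rewrite (_ : low = [set w | (k./2 < count (fun l => b l w) (iota 0 k))%N]); last first.
  apply/seteqP; split=> w /=; rewrite /low /= /med /median_of_moments
    (@median_map_majority _ (fun x => x < rho / 2) (block_moment 1 m (Ys^~ w)) k)//;
  by right => x y xy yr; exact: le_lt_trans yr.
apply: (@median_prob (block 0 m) b) => //.
- by move=> i j; exact: block_disjoint.
- move=> l; rewrite -[X in events _ _ X]setTI.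
  apply: (@measurable_fun_ltr _ (g_sigma_algebraType (cylinders Ys (block 0 m l)))) => //.
  exact: adapted_block_moment.
- move=> l; exact: (stage1_block iidY r12 kap_ge0 Yint abs1 mean0 momr).
Qed.

Let large (j : nat) := (0 < j)%N && (eta * (rho / 2) `^ s <= j%:R).

Let toofar_prob j : large j -> (P (toofar j) <= (delta / 2)%:E)%E.
Proof.
move=> /andP[j0 jge].
apply: (@median_prob (block (k * m) j) (far j)) => //.
- by move=> i l; exact: block_disjoint.
- move=> l; exact: (stage2_block iidY r12 kap_ge0 Yint abs1 mean0 momr).
Qed.

Lemma adaptive_algorithm_accurate :
  ((1 - delta)%:E <= P [set w | (`|output A (Ys^~ w) - mean P Y| <= eps)%R])%E.
Proof.
pose S j := [set w | ssize w = j].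
(* For a size that is not [large] stage 2 has no guarantee. Such sizes occur only on [low], so
   failure may be declared empty there. *)
pose H j := if large j then toofar j else set0.
have mS j : measurable (S j) := events_measurable (@ssize_events j).
have mH j : measurable (H j).
  by rewrite /H; case: ifP => // _; exact: events_measurable (@toofar_events j).
pose bad := low `|` \bigcup_j (S j `&` H j).
have mU : measurable (\bigcup_j (S j `&` H j)).
  by apply: bigcup_measurable => j _; exact: measurableI.
have mbad : measurable bad by exact: measurableU.
have half0 : 0 <= delta / 2 by rewrite divr_ge0// ltW.
have Uprob : (P (\bigcup_j (S j `&` H j)) <= (delta / 2)%:E)%E.
  apply: prob_random_index => //.
    by apply/trivIsetP => i j _ _ ij; apply/seteqP; split=> // w /= [wi wj];
      move: ij; rewrite -wi -wj eqxx.
  move=> j; rewrite /H; case: ifPn => [lj|_]; last first.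
    by rewrite setI0 measure0 mule_ge0.
  have AB : [set i | (i < k * m)%N] `&` [set i | (k * m <= i)%N] = set0.
    by apply/seteqP; split=> // i /= [ik ki]; move: ki; rewrite leqNgt ik.
  rewrite (events_indep indepY AB (@ssize_events j) (@toofar_events j)).
  by rewrite muleC lee_wpmul2r// toofar_prob.
have badP : (P bad <= delta%:E)%E.
  apply: (le_trans (measureU2 P low_measurable mU)).
  have -> : (delta%:E = (delta / 2)%:E + (delta / 2)%:E)%E.
    by rewrite -EFinD; congr EFin; field.
  exact: leeD.
apply: (@le_trans _ _ (P (~` bad))).
  by rewrite probability_setC// EFinB leeB.
apply: le_measure; rewrite ?inE//; first exact: measurableC.
move=> w wbad; rewrite /= leNgt; apply/negP => outw; apply: wbad.
have [wl|medge] := ltP (med w) (rho / 2); first by left.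
right; exists (ssize w) => //; split => //.
have lw : large (ssize w).
  rewrite /large sample_size_gt0/=; apply: le_trans (sample_size_ge s (med w) eta_ge0).
  rewrite ler_wpM2l// ge0_ler_powR ?nnegrE ?divr_ge0//.
  by apply: le_trans medge; rewrite divr_ge0.
rewrite /H lw /toofar /=.
exact: (median_far (F := fun l w => block_mean (k * m) (ssize w) (Ys^~ w) l)
  odd_k' outw).
Qed.

End Accuracy.

Section Cost.
Hypothesis k_ge : 4 / (r - 1) <= k%:R.

Let N := k./2.+1.

Let med_ge0 w : 0 <= med w.
Proof.
rewrite /med /median_of_moments.
set F := block_moment 1 m (Ys^~ w).
rewrite (@median_map_majority _ (fun x => 0 <= x) F k)//; last first.
  by left => x y xy x0; exact: le_trans xy.
rewrite (eq_count (a2 := predT)).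
  by rewrite count_predT size_iota half_odd_lt.
by move=> l /=; rewrite block_moment_ge0.
Qed.

(** From k >= 4/(r-1) and k <= 2N follows N >= 2/(r-1), and 1/(r-1) >= 1 because r <= 2. *)
Let s_le_N : s <= N%:R.
Proof.
have /andP[r1 r2] := r12.
have u0 : 0 < r - 1 by rewrite subr_gt0.
have u1 : 1 <= (r - 1)^-1 by rewrite invf_ge1//; lra.
have kN : k%:R <= 2 * N%:R :> R.
  by rewrite -natrM ler_nat leq_double_halfS.
have := k_ge; rewrite /s; move: ((r - 1)^-1) u1 => x x1; lra.
Qed.

(* The scale [e] will be [8 * rho + eps]; adding [eps] keeps it positive when
   [rho = 0]. *)
Let med_moment (e : R) : 8 * rho <= e -> 0 < e ->
  (\int[P]_w (med w `^ s)%:E <= (2 * e `^ s)%:E)%E.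
Proof.
move=> rhoe e0.
pose f l w := block_moment 1 m (Ys^~ w) l.
have f0 l w : 0 <= f l w by exact: block_moment_ge0.
have dB i j : i != j -> block 0 m i `&` block 0 m j = set0 by exact: block_disjoint.
have fA l : adapted Ys (block 0 m l) (f l) by exact: adapted_block_moment.
have fM l : (\int[P]_w (f l w)%:E <= (2 * rho)%:E)%E.
  exact: (block_moment_mean iidY abs1 l m_gt0).
have es0 w : 0 <= elem_sym (f^~ w) k N by exact: elem_sym_ge0.
have esM : (\int[P]_w (elem_sym (f^~ w) k N)%:E <= (e ^+ N)%:E)%E.
  apply: (le_trans (integral_elem_sym indepY dB f0 fA fM k N)); rewrite lee_fin.
  (* As k <= 2N, the binomial coefficient is at most 2^k <= 4^N, which turns the mean bound 2 rho
     into 8 rho. *)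
  apply: (@le_trans _ _ ((4 * (2 * rho)) ^+ N)).
    rewrite [leRHS]exprMn ler_wpM2r ?exprn_ge0 ?mulr_ge0//.
    rewrite -natrX ler_nat; apply: (leq_trans (bin_le_expn2 _ _)).
    by rewrite (_ : 4 = 2 ^ 2)%N// -expnM leq_exp2l// leq_double_halfS.
  by rewrite lerXn2r ?nnegrE ?mulr_ge0 ?(ltW e0)// mulrA -natrM.
have mes : measurable_fun setT (fun w => elem_sym (f^~ w) k N).
  exact: adapted_measurable (@adapted_elem_sym _ _ _ P Ys _ f fA k N).
have eN0 : 0 < e ^+ N by rewrite exprn_gt0.
have c0 : 0 <= e `^ s / e ^+ N by rewrite divr_ge0 ?powR_ge0// ltW.
apply: (@le_trans _ _ (\int[P]_w ((e `^ s)%:E + (e `^ s / e ^+ N)%:E *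
    (elem_sym (f^~ w) k N)%:E))%E).
  apply: ge0_le_integral => //.
  - by move=> w _; rewrite lee_fin powR_ge0.
  - apply/measurable_EFinP; apply: (measurableT_comp (measurable_powR s)).
    exact: adapted_measurable adapted_med.
  - apply: emeasurable_funD => //; apply/measurable_EFinP; exact: measurable_funM.
  - move=> w _; rewrite -EFinM -EFinD lee_fin.
    (* At least N of the block statistics are no smaller than their median. *)
    have medN : med w ^+ N <= elem_sym (f^~ w) k N.
      apply: exprn_le_elem_sym => //.
      rewrite /N -(@median_map_majority _ (fun x => med w <= x) (f^~ w) k)//.
      by left => x y xy; move/le_trans; apply.
    have x0 : 0 <= med w / e by rewrite divr_ge0// ltW.
    (* Only s <= N is used here: x^s is at most 1 for x <= 1 and at most x^N beyond. *)
    have xs : (med w / e) `^ s <= 1 + (med w / e) ^+ N.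
      have [x1|x1] := leP (med w / e) 1.
        apply: (@le_trans _ _ 1); last by rewrite lerDl exprn_ge0.
        have := ge0_ler_powR s_ge0 _ _ x1; rewrite !nnegrE powR1.
        by apply.
      apply: (@le_trans _ _ ((med w / e) ^+ N)); last by rewrite lerDr.
      by rewrite -powR_mulrn// ler_powR// ltW.
    have -> : med w `^ s = e `^ s * (med w / e) `^ s.
      by rewrite -powRM// ?(ltW e0)// mulrC divfK// gt_eqF.
    apply: (@le_trans _ _ (e `^ s * (1 + (med w / e) ^+ N))).
      by rewrite ler_wpM2l ?powR_ge0.
    rewrite mulrDr mulr1 lerD2l expr_div_n mulrCA [leLHS]mulrC.
    exact: ler_wpM2l.
rewrite ge0_integralD_scale ?powR_ge0//.
rewrite integral_cst_prob.
apply: (@le_trans _ _ ((e `^ s)%:E + (e `^ s / e ^+ N)%:E * (e ^+ N)%:E)%E).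
  by rewrite leeD2l// lee_wpmul2l// lee_fin.
by rewrite -EFinM -EFinD lee_fin divfK ?gt_eqF//; lra.
Qed.

Lemma adaptive_algorithm_cost :
  (expected_cost P A Ys <=
   (k%:R * m%:R + k'%:R * (1 + eta * (2 * (8 * rho + eps) `^ s)))%:E)%E.
Proof.
have e0 : 0 < 8 * rho + eps by rewrite ltr_wpDl// mulr_ge0.
have medM := @med_moment (8 * rho + eps) ltac:(by rewrite lerDl ltW) e0.
have k'eta : 0 <= k'%:R * eta by rewrite mulr_ge0.
have mmed : measurable_fun setT (fun w => med w `^ s).
  apply: (measurableT_comp (measurable_powR s)).
  exact: adapted_measurable adapted_med.
have mss : measurable_fun setT (fun w => (ssize w)%:R : R).
  exact: (measurableT_comp (measurable_sample_size s eta_ge0) (adapted_measurable adapted_med)).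
rewrite /expected_cost unlock.
apply: (@le_trans _ _ (\int[P]_w ((k%:R * m%:R + k'%:R)%:E +
   (k'%:R * eta)%:E * (med w `^ s)%:E))%E).
  apply: ge0_le_integral => //.
  - apply/measurable_EFinP; rewrite (_ : (fun w => _) =
       (fun w => k%:R * m%:R + k'%:R * (ssize w)%:R)).
      by apply: measurable_funD => //; exact: measurable_funM.
    by apply/funext => w; rewrite /= natrD !natrM.
  - apply: emeasurable_funD => //; apply/measurable_EFinP; exact: measurable_funM.
  - move=> w _; rewrite -EFinM -EFinD lee_fin /= natrD !natrM -addrA lerD2l.
    rewrite -mulrA -[X in X + _]mulr1 -mulrDr ler_wpM2l//.
    exact: (sample_size_le s (med w) eta_ge0).
rewrite ge0_integralD_scale//; last by move=> w; exact: powR_ge0.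
rewrite integral_cst_prob.
apply: (le_trans (leeD2l _ (lee_wpmul2l _ medM))); first by rewrite lee_fin.
by rewrite -EFinM -EFinD lee_fin; lra.
Qed.

End Cost.

End AdaptiveAlgorithm.

(** * The parameters in terms of min(q, 2), and the cost constant *)

Lemma least_odd_geq_le (R : realType) (x : R) k : 0 <= x -> least_odd_geq x k ->
  k%:R <= x + 2.
Proof.
move=> x0 [ok _ kmin].
have [k3|k3] := leqP 3 k; last first.
  have : k%:R <= 2 :> R by rewrite ler_nat -ltnS.
  lra.
have [xk|xk] := leP x (k - 2)%:R.
  have /(_ xk) := kmin (k - 2)%N ltac:(lia); lia.
have k2 : (2 <= k)%N by apply: leq_trans k3.
by move: xk; rewrite natrB//; lra.
Qed.

Section MomentOrder.
Variables (R : realType) (q : \bar R).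
Hypothesis q_gt1 : (1%:E < q)%E.
Let r := moment_order q.

Lemma moment_order_bounds : 1 < moment_order q <= 2.
Proof.
rewrite /moment_order; move: q_gt1; case: q => [t| |]//=; last first.
  by move=> _; rewrite ltr1n lexx.
by rewrite lte_fin lee_fin => t1; case: (leP t 2) => t2 /=; rewrite ?t1 ?t2// ltr1n lexx.
Qed.

Lemma inv_predE : (q <= 2%:E)%E -> inv_pred q = (r - 1)^-1.
Proof. by rewrite /r /moment_order => q2; rewrite q2; case: q q2 q_gt1. Qed.

Lemma moment_order_gt2 : (q <= 2%:E)%E = false -> r = 2.
Proof. by rewrite /r /moment_order => ->. Qed.

Let inv1 : (2 - 1 : R)^-1 = 1.
Proof. by rewrite -[X in X - 1]/(1 + 1) addrK invr1. Qed.

Lemma size_exponentE : size_exponent q = 1 + (r - 1)^-1.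
Proof.
rewrite /size_exponent; case: ifPn => [/inv_predE ->//|/negbTE/moment_order_gt2 ->].
by rewrite inv1.
Qed.

Lemma size_factorE p K eps : 0 < eps -> size_factor p q K eps =
  16 `^ (r - 1)^-1 * K `^ ratio_exponent p q * eps `^ (- (1 + (r - 1)^-1)).
Proof.
move=> eps0; rewrite /size_factor; case: ifPn => [/inv_predE ->//|/negbTE/moment_order_gt2 ->].
by rewrite inv1 powRr1// (_ : 1 + 1 = 2%:R)// powRN powR_mulrn// ltW.
Qed.

(** For q > 2 one has r = 2, and 3 times 48 is the constant 144. *)
Lemma first_block_sizeE p K : first_block_size p q K =
  ceil_nat (3 * 48 `^ (r - 1)^-1 * K `^ ratio_exponent p q).
Proof.
rewrite /first_block_size; case: ifPn => [/inv_predE ->//|/negbTE/moment_order_gt2 ->].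
by rewrite inv1 powRr1// -natrM.
Qed.

Lemma inv_pred_le1 : (q <= 2%:E)%E = false -> 0 <= inv_pred q <= 1.
Proof.
case: q q_gt1 => [t| |]//=; last by rewrite lexx ler01.
rewrite lte_fin lee_fin => t1 /negbT; rewrite -ltNge => t2.
by rewrite invr_ge0 subr_ge0 (ltW t1) invf_le1 ?subr_gt0//; lra.
Qed.

Let inv_ge1 : 1 <= (r - 1)^-1.
Proof.
by have /andP[r1 r2] := moment_order_bounds; rewrite /r invf_ge1 ?subr_gt0//; lra.
Qed.

Lemma max_exponentE : Num.max (1 + inv_pred q) 2 = 1 + (r - 1)^-1.
Proof.
case: (boolP (q <= 2%:E)%E) => [/inv_predE ->|/negbTE q2].
  by rewrite max_l//; have := inv_ge1; lra.
rewrite (moment_order_gt2 q2) inv1 max_r//.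
by have /andP[_] := inv_pred_le1 q2; lra.
Qed.

Lemma max_repetitionsE : Num.max (4 * inv_pred q) 4 = 4 / (r - 1).
Proof.
case: (boolP (q <= 2%:E)%E) => [/inv_predE ->|/negbTE q2].
  by rewrite max_l//; have := inv_ge1; lra.
rewrite (moment_order_gt2 q2) inv1 mulr1 max_r//.
by have /andP[_] := inv_pred_le1 q2; lra.
Qed.

Lemma ratio_exponent_ge0 p : 1 <= p -> (p%:E < q)%E -> 0 <= ratio_exponent p q.
Proof.
rewrite /ratio_exponent; case: q => [t| |]//= p1; last by move=> _; apply: le_trans p1.
rewrite lte_fin => pt; rewrite divr_ge0 ?mulr_ge0 ?subr_ge0 ?(ltW pt)//.
- exact: le_trans p1.
- by apply: le_trans (ltW pt); apply: le_trans p1.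
Qed.

End MomentOrder.

(** The first factor bounds k and k' by a multiple of L = log(1/delta): additive constants are
    absorbed through L >= ln 2, that is, delta < 1/2. In the second factor, 3 48^(1/(r-1)) + 1
    bounds m/kap, and the rest bounds the mean stage-2 size, where 2^(s-1) 8^s stems from (8 rho/eps
    + 1)^s <= 2^(s-1) ((8 rho/eps)^s + 1). *)
Definition cost_constant (R : realType) (r : R) : R :=
  (2 / ln (4 / 3) + (4 / (r - 1) + 2) / ln 2) *
  (3 * 48 `^ (r - 1)^-1 + 1 +
   (1 + 2 * 16 `^ (r - 1)^-1 *
     (2 `^ (1 + (r - 1)^-1 - 1) * 8 `^ (1 + (r - 1)^-1)))).

Lemma cost_constant_bound (R : realType) (r kap rho eps L m k k' : R) :
  1 < r <= 2 -> 1 <= kap -> 0 <= rho -> 0 < eps -> ln 2 <= L -> 0 <= m -> 0 <= k' ->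
  m <= 3 * 48 `^ (r - 1)^-1 * kap + 1 ->
  k <= Num.max (2 * L / ln (4 / 3)) (4 / (r - 1)) + 2 ->
  k' <= 2 * L / ln (4 / 3) + 2 ->
  k * m + k' * (1 + 16 `^ (r - 1)^-1 * kap * eps `^ (- (1 + (r - 1)^-1)) *
     (2 * (8 * rho + eps) `^ (1 + (r - 1)^-1))) <=
  cost_constant r * kap * (1 + (rho / eps) `^ (1 + (r - 1)^-1)) * L.
Proof.
move=> /andP[r1 r2] kap1 rho0 eps0 L2 m0 k'0 mle kle k'le.
have u0 : 0 < (r - 1)^-1 by rewrite invr_gt0 subr_gt0.
have ln2 : 0 < ln 2 :> R by rewrite ln_gt0// ltr1n.
have L0 : 0 < L by apply: lt_le_trans L2.
have l43 : 0 < ln (4 / 3) :> R by rewrite ln_gt0//; lra.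
rewrite /cost_constant; set v := (r - 1)^-1 in u0 mle kle *.
set s := 1 + v; set c2 := 2 / ln (4 / 3) + _.
have s1 : 1 <= s by rewrite /s lerDl ltW.
have c2E : 2 * L / ln (4 / 3) + 4 * v + 2 <= c2 * L.
  have -> : c2 * L = 2 * L / ln (4 / 3) + (4 * v + 2) * (L / ln 2).
    by rewrite /c2; ring.
  rewrite -addrA lerD2l ler_peMr//; last by rewrite ler_pdivlMr// mul1r.
  by rewrite addr_ge0// mulr_ge0// ltW.
have v4 : 0 <= 4 * v by rewrite mulr_ge0// ltW.
have Ll0 : 0 <= 2 * L / ln (4 / 3) by rewrite divr_ge0 ?mulr_ge0 ?(ltW L0) ?(ltW l43).
have kc : k <= c2 * L.
  apply: le_trans c2E; apply: (le_trans kle); rewrite lerD2r ge_max.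
  by rewrite lerDl v4 lerDr Ll0.
have k'c : k' <= c2 * L by lra.
have cL0 : 0 <= c2 * L by lra.
set t := (rho / eps) `^ s.
have t0 : 0 <= t by exact: powR_ge0.
set c1 := 3 * 48 `^ v + 1; set c3 := 1 + 2 * 16 `^ v * (2 `^ (s - 1) * 8 `^ s).
have mc : m <= c1 * kap by rewrite /c1 mulrDl mul1r; lra.
have g0 : 0 <= 2 `^ (s - 1) * 8 `^ s :> R by rewrite mulr_ge0 ?powR_ge0.
have h0 : 0 <= 16 `^ v :> R by exact: powR_ge0.
have base : (8 * rho + eps) `^ s * eps `^ (- s) <= 2 `^ (s - 1) * 8 `^ s * (1 + t).
  have -> : (8 * rho + eps) `^ s * eps `^ (- s) = (8 * (rho / eps) + 1) `^ s.
    have -> : 8 * (rho / eps) + 1 = (8 * rho + eps) * eps^-1 by field; rewrite gt_eqF.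
    rewrite powRM ?invr_ge0 ?addr_ge0 ?mulr_ge0 ?(ltW eps0)//.
    by rewrite -[eps^-1]powR_inv1 ?(ltW eps0)// -powRrM mulN1r.
  apply: (le_trans (powR_add_le s1 _ _)) => //.
    by rewrite mulr_ge0// divr_ge0// ltW.
  rewrite -mulrA ler_wpM2l ?powR_ge0// powRM// ?divr_ge0 ?(ltW eps0)// powR1 -/t.
  have e1 : 1 <= 8 `^ s :> R by rewrite powR_ge1 ?ler1n// (le_trans ler01).
  by rewrite /= mulrDr mulr1 [leLHS]addrC lerD2r.
have second : 1 + 16 `^ v * kap * eps `^ (- s) * (2 * (8 * rho + eps) `^ s) <=
    kap * (c3 * (1 + t)).
  have -> : 16 `^ v * kap * eps `^ (- s) * (2 * (8 * rho + eps) `^ s) =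
    kap * (2 * 16 `^ v * ((8 * rho + eps) `^ s * eps `^ (- s))) by ring.
  have hb : 2 * 16 `^ v * ((8 * rho + eps) `^ s * eps `^ (- s)) <=
      2 * 16 `^ v * (2 `^ (s - 1) * 8 `^ s * (1 + t)).
    by rewrite ler_wpM2l// mulr_ge0.
  have hk : kap * (2 * 16 `^ v * ((8 * rho + eps) `^ s * eps `^ (- s))) <=
      kap * (2 * 16 `^ v * (2 `^ (s - 1) * 8 `^ s * (1 + t))).
    by rewrite ler_wpM2l//; lra.
  have -> : kap * (c3 * (1 + t)) =
    kap * (1 + t) + kap * (2 * 16 `^ v * (2 `^ (s - 1) * 8 `^ s * (1 + t))).
    by rewrite /c3; ring.
  apply: lerD => //; apply: (le_trans kap1).
  by rewrite ler_peMr ?lerDl//; lra.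
have c10 : 0 <= c1 by rewrite addr_ge0 ?mulr_ge0 ?powR_ge0.
have first : k * m <= c2 * L * (c1 * kap * (1 + t)).
  apply: (@le_trans _ _ (c2 * L * m)); first by rewrite ler_wpM2r.
  rewrite ler_wpM2l//; apply: (le_trans mc).
  by rewrite ler_peMr ?lerDl// mulr_ge0//; lra.
have W0 : 0 <= 1 + 16 `^ v * kap * eps `^ (- s) * (2 * (8 * rho + eps) `^ s).
  by rewrite addr_ge0// !mulr_ge0 ?powR_ge0//; lra.
have third : k' * (1 + 16 `^ v * kap * eps `^ (- s) * (2 * (8 * rho + eps) `^ s)) <=
    c2 * L * (kap * (c3 * (1 + t))).
  by apply: ler_pM.
have -> : c2 * (c1 + c3) * kap * (1 + t) * L =
  c2 * L * (c1 * kap * (1 + t)) + c2 * L * (kap * (c3 * (1 + t))) by ring.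
exact: lerD.
Qed.

Lemma cost_constant_gt0 (R : realType) (r : R) : 1 < r -> 0 < cost_constant r.
Proof.
move=> r1; have ln2 : 0 < ln 2 :> R by rewrite ln_gt0// ltr1n.
have l43 : 0 < ln (4 / 3) :> R by rewrite ln_gt0//; lra.
have v0 : 0 <= 4 / (r - 1) by rewrite divr_ge0// subr_ge0 ltW.
apply: mulr_gt0.
  by rewrite ltr_pwDl ?divr_gt0// divr_ge0 ?addr_ge0 ?(ltW ln2).
have p0 a b : 0 <= a `^ b :> R by exact: powR_ge0.
by rewrite ltr_wpDl ?addr_ge0 ?mulr_ge0//.
Qed.

Theorem theorem2p17 (R : realType) (q : \bar R) (q_gt1 : (1%:E < q)%E) :
  exists2 C : R, 0 < C &
    forall (p : R), 1 <= p -> (p%:E < q)%E ->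
    forall (d : measure_display) (T : measurableType d) (P : probability T R)
           (K eps delta : R),
      1 < K -> 0 < eps -> 0 < delta -> delta < 1 / 2 ->
    forall k k' : nat,
      least_odd_geq
        (Num.max (2 * ln delta^-1 / ln (4 / 3)) (Num.max (4 * inv_pred q) 4)) k ->
      least_odd_geq (2 * ln delta^-1 / ln (4 / 3)) k' ->
    let A := adaptive_algorithm k 1 (first_block_size p q K) k'
               (size_exponent q) (size_factor p q K eps) in
    approximating P eps delta A (norm_ratio_class P p q K) /\
    forall (Y : {RV P >-> R}) (Ys : nat -> {RV P >-> R}),
      norm_ratio_class P p q K Y -> iid_copies P Y Ys ->
      (expected_cost P A Ys <=
       (C * K `^ ratio_exponent p q *
        (1 + (fine (centered_norm P 1%:E Y) / eps) `^ Num.max (1 + inv_pred q) 2) *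
        ln delta^-1)%:E)%E.
Proof.
have r12 := moment_order_bounds q_gt1; have /andP[r1 r2] := r12.
exists (cost_constant (moment_order q)); first exact: cost_constant_gt0.
move=> p p1 pq d T P K eps delta K1 eps0 d0 d12 k k' kmin k'min A.
have [ok kge _] := kmin; have [ok' k'ge _] := k'min.
move: kge; rewrite ge_max => /andP[kge]; rewrite max_repetitionsE// => kge4.
have kap1 : 1 <= K `^ ratio_exponent p q.
  by apply: powR_ge1; [exact: ltW|exact: ratio_exponent_ge0].
have kap0 : 0 <= K `^ ratio_exponent p q := powR_ge0 _ _.
have x0 : 0 < 3 * 48 `^ (moment_order q - 1)^-1 * K `^ ratio_exponent p q.
  by rewrite !mulr_gt0 ?powR_gt0//; lra.
have m_ge := ceil_nat_ge (ltW x0).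
have m_gt0 : (0 < ceil_nat (3 * 48 `^ (moment_order q - 1)^-1 * K `^ ratio_exponent p q))%N.
  by rewrite -(ltr_nat R); apply: lt_le_trans m_ge.
rewrite /A first_block_sizeE// size_exponentE// size_factorE//.
split=> [Y Ys YF iidY|Y Ys YF iidY].
  exact: (adaptive_algorithm_accurate iidY r12 kap0 (class_integrable q_gt1 YF)
    (centered_abs_moment q_gt1 YF) (centered_mean q_gt1 YF)
    (class_moment p1 pq q_gt1 K1 YF) m_gt0 m_ge eps0 ok ok' d0 d12 kge k'ge).
have abs1 := centered_abs_moment q_gt1 YF.
have rho0 : 0 <= fine (centered_norm P 1%:E Y).
  by rewrite -lee_fin -abs1; apply: integral_ge0 => w _; rewrite lee_fin.
apply: (le_trans (adaptive_algorithm_cost iidY k' r12 kap0 abs1 m_gt0 eps0 ok kge4)).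
rewrite lee_fin max_exponentE//; apply: cost_constant_bound => //.
- by rewrite ler_ln ?posrE ?invr_gt0// -(ler_pM2l d0) mulfV ?gt_eqF//; lra.
- by have := ceil_nat_lt (ltW x0); exact: ltW.
- have := least_odd_geq_le _ kmin; rewrite max_repetitionsE//; apply.
  by rewrite le_max [X in _ || X]divr_ge0 ?orbT// subr_ge0 ltW.
- apply: least_odd_geq_le k'min.
  have i1 : 1 <= delta^-1 by rewrite invf_ge1//; lra.
  have i2 : 1 <= 4 / 3 :> R by lra.
  by rewrite divr_ge0 ?mulr_ge0 ?ln_ge0.
Qed.
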